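(* Let $\xi$ be a real random variable with $\mathbb{E} e^{\xi}=\tfrac12$, $\mathbb{E}\,\xi e^{\xi}=0$ and $\mathbb{E} e^{(1+h)\xi}<\infty$ for some $h>0$, and let $\mu_1$ be the associated critical Mandelbrot cascade measure on $[0,1]$. Then almost surely $\mu_1$ has no atoms.
   Context: Notation: $\Sigma_n=\{0,1\}^n$, $\Sigma=\bigcup_{n\ge1}\Sigma_n$. Let $(\xi_\sigma)_{\sigma\in\Sigma}$ be independent copies of $\xi$; for $\sigma=\sigma_1\cdots\sigma_n\in\Sigma_n$ put $X_\sigma=\xi_{\sigma_1}+\xi_{\sigma_1\sigma_2}+\cdots+\xi_{\sigma_1\sigma_2\cdots\sigma_n}$, and let $I_\sigma\subset[0,1]$ be the dyadic interval of length $2^{-n}$ with left endpoint $\sum_{k=1}^n\sigma_k2^{-k}$. Critical measure: let $\mu_{1,n}$ be the random measure on $[0,1]$ whose density with respect to Lebesgue measure is constant on each $I_\sigma$, $\sigma\in\Sigma_n$, and with $\mu_{1,n}(I_\sigma)=n^{1/2}e^{X_\sigma}$. It is known that $n^{1/2}\sum_{\sigma\in\Sigma_n}e^{X_\sigma}$ converges in probability to a random variable $Y_1$ with $0<Y_1<\infty$ almost surely, and that $\mu_{1,n}$ converges weakly in probability, as $n\to\infty$, to a random finite measure $\mu_1$ on $[0,1]$. For every $n\ge1$, $(\mu_1(I_\sigma))_{\sigma\in\Sigma_n}$ has the same law as $(e^{X_\sigma}Y_1^{(\sigma)})_{\sigma\in\Sigma_n}$, where $(Y_1^{(\sigma)})_{\sigma\in\Sigma_n}$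 are independent copies of $Y_1$, independent of $(X_\sigma)_{\sigma\in\Sigma_n}$. *)

(* Defs.v *)
From HB Require Import structures.
From mathcomp Require Import all_boot all_order all_algebra.
From mathcomp Require Import all_classical all_reals all_analysis.
From mathcomp Require Import measurable_realfun.

Set Implicit Arguments.
Unset Strict Implicit.
Unset Printing Implicit Defensive.

Import Order.TTheory GRing.Theory Num.Theory.
Import numFieldNormedType.Exports.

Local Open Scope classical_set_scope.
Local Open Scope ring_scope.

(* Finite or infinite families alike: the product rule is imposed on every
   finite subfamily, listed without repetition by [s], with indices in [D]. *)
Definition mutually_independent d (T : measurableType d) (R : realType)
    (P : probability T R) (I : choiceType) (D : set I)
    (X : I -> {RV P >-> R}) : Prop :=
  forall (s : seq I) (A : I -> set R),
    uniq s -> (forall i, i \in s -> D i) -> (forall i, measurable (A i)) ->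
    P (\bigcap_(i in [set` s]) (X i @^-1` A i))
      = (\prod_(i <- s) P (X i @^-1` A i))%E.

Definition identically_distributed d1 d2 (T1 : measurableType d1)
    (T2 : measurableType d2) (R : realType) (P1 : probability T1 R)
    (P2 : probability T2 R) (X : {RV P1 >-> R}) (Y : {RV P2 >-> R}) : Prop :=
  forall A : set R, measurable A -> distribution P1 X A = distribution P2 Y A.

Definition cvg_in_probability d (T : measurableType d) (R : realType)
    (P : probability T R) (X : nat -> T -> R) (Y : T -> R) : Prop :=
  forall e : R, 0 < e ->
    P [set w | e <= `|X n w - Y w|] @[n --> \oo] --> 0%E.

(* Weak convergence in probability of random measures on the compact interval
   [0, 1]: the integral of every continuous test function converges in
   probability. *)
Definition weak_cvg_in_probability d (T : measurableType d) (R : realType)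
    (P : probability T R) (nu : nat -> T -> {measure set R -> \bar R})
    (mu : T -> {measure set R -> \bar R}) : Prop :=
  forall f : R -> R, {within `[0, 1], continuous f} ->
    cvg_in_probability P
      (fun n w => \int[nu n w]_(x in `[0, 1]) f x)
      (fun w => \int[mu w]_(x in `[0, 1]) f x).

Section cascade.
Context (R : realType).

(* A word s_1 ... s_n is a boolean sequence, s_k being [nth false s k.-1]. *)
Definition dyadic_left (s : seq bool) : R :=
  \sum_(k < size s) (nth false s k)%:R / 2 ^+ k.+1.

(* Half-open, so that the words of length n partition [0, 1). *)
Definition dyadic_itv (s : seq bool) : set R :=
  `[dyadic_left s, dyadic_left s + 2 ^- size s[.

Context d (T : measurableType d) (xi : seq bool -> T -> R).

Definition branch_sum (s : seq bool) (w : T) : R :=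
  \sum_(k < size s) xi (take k.+1 s) w.

(* Mass n^(1/2) e^(X_s) spread uniformly on the interval I_s of length 2^-n. *)
Definition critical_density (n : nat) (w : T) (x : R) : R :=
  \sum_(s : n.-tuple bool)
     Num.sqrt n%:R * expR (branch_sum s w) / 2 ^- n * \1_(dyadic_itv s) x.

Definition critical_approx (n : nat) (w : T) (A : set R) : \bar R :=
  (\int[lebesgue_measure]_(x in A) (critical_density n w x)%:E)%E.

Lemma critical_density_ge0 n w x : 0 <= critical_density n w x.
Proof.
by apply: sumr_ge0 => s _; rewrite mulr_ge0.
Qed.

Lemma measurable_critical_density n w :
  measurable_fun [set: R] (critical_density n w).
Proof.
apply: measurable_sum => s; apply: measurable_funM => //.
by apply: measurable_indic; exact: measurable_itv.
Qed.

Let critical_approx0 n w : critical_approx n w set0 = 0%E.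
Proof. exact: integral_set0. Qed.

Let critical_approx_ge0 n w A : (0 <= critical_approx n w A)%E.
Proof.
by apply: integral_ge0 => x _; rewrite lee_fin critical_density_ge0.
Qed.

Let critical_approx_sigma_additive n w :
  semi_sigma_additive (critical_approx n w).
Proof.
move=> F mF tF mUF; rewrite /critical_approx ge0_integral_bigcup//.
- apply: is_cvg_ereal_nneg_natsum_cond => k _ _; exact: critical_approx_ge0.
- apply/measurable_EFinP; apply: measurable_funTS.
  exact: measurable_critical_density.
- by move=> x _; rewrite lee_fin critical_density_ge0.
Qed.

HB.instance Definition _ n w := isMeasure.Build _ _ _ (critical_approx n w)
  (critical_approx0 n w) (critical_approx_ge0 n w)
  (@critical_approx_sigma_additive n w).

End cascade.

Definition no_atoms (R : realType) (mu : {measure set R -> \bar R}) : Prop :=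
  forall x : R, mu [set x] = 0%E.

(* Main.v *)
(* Fix a barrier a and write y = a - X_s for the distance of a particle to it.
   With probability at least 1 - e^(-a) no particle ever crosses the barrier,
   because the crossing particles take their weight e^(X_s) > e^a out of the
   mass one of the cascade; so the particles that cross may be killed.

   By the many-to-one formula the killed cascade is governed by a random walk
   with step law 2 e^x P(xi in dx), which is centred and has exponential
   moments.  For this walk killed below 0, R(y) = y + K - e^(-delta y) is
   superharmonic with a drift of order e^(-delta y), and adding
   1 - e^(-theta y), theta of order N^(-1/2), gives a function showing that the
   walk started at y survives N steps with probability O(R(y) / sqrt N).

   Hence, given the first m generations, the expected killed mass of the
   approximation of order 2m near a dyadic point is at most a constant times
   B_m, the sum of e^(X_s) R(y_s) over the words of length m near that point.
   The second moment of B_m grows from m to m + 1 by at most its diagonal part;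
   since e^(2 X_s) R(y_s)^2 <= C e^a e^(X_s) e^(-delta y_s), the drift makes
   these increments summable over all words.  Testing the mass at time 2m
   against the event that the mass at time m is at least 2 epsilon bounds the
   probability that some tent of scale 2^(-k) has mass 3 epsilon by the tail of
   order k of this series, which tends to 0.  A large atom would give one tent
   of every scale a large mass. *)
From HB Require Import structures.
Require Import Defs.
From mathcomp Require Import all_boot all_order all_algebra.
From mathcomp Require Import all_classical all_reals all_analysis.
From mathcomp Require Import measurable_realfun ring lra.

Set Implicit Arguments.
Unset Strict Implicit.
Unset Printing Implicit Defensive.

Import Order.TTheory GRing.Theory Num.Theory.
Import numFieldNormedType.Exports.

Local Open Scope classical_set_scope.
Local Open Scope ring_scope.

(** * Integrating out one step *)

Section one_step.
Context (R : realType) d0 (T0 : measurableType d0) (P0 : probability T0 R)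
  (xi : {RV P0 >-> R}) d (T : measurableType d) (P : probability T R)
  (xis : seq bool -> {RV P >-> R}).
Context
  (hlaw : forall s : seq bool, s != [::] -> identically_distributed (xis s) xi)
  (hindep : mutually_independent [set s : seq bool | s != [::]] xis).

(* A pi-system that generates the sigma-algebra of all the variables but [xis s0]. *)
Definition cylinders_off (s0 : seq bool) : set (set T) :=
  [set B | exists (l : seq (seq bool)) (A : seq bool -> set R),
    [/\ uniq l, forall s, s \in l -> s != [::] /\ s != s0,
        forall s, measurable (A s) &
        B = \bigcap_(s in [set` l]) (xis s @^-1` A s)] ].

(** The carrier is still [T]: measurability without knowledge of [xis s0] becomes ordinary
    measurability of a function with domain [words_off s0]. *)
Definition words_off (s0 : seq bool) := g_sigma_algebraType (cylinders_off s0).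

Lemma cylinders_off_setI s0 : setI_closed (cylinders_off s0).
Proof.
move=> _ _ [l1 [A1 [u1 h1 m1 ->]]] [l2 [A2 [u2 h2 m2 ->]]].
exists (undup (l1 ++ l2)).
exists (fun s => (if s \in l1 then A1 s else setT) `&`
                 (if s \in l2 then A2 s else setT)).
split.
- exact: undup_uniq.
- by move=> s; rewrite mem_undup mem_cat => /orP[/h1|/h2].
- by move=> s; apply: measurableI; case: ifP.
- apply/seteqP; split=> w /=.
    move=> [h1' h2'] s /= _; split.
      by case: ifPn => // sl1; exact: h1'.
    by case: ifPn => // sl2; exact: h2'.
  move=> h; split=> s /= sl.
    by have := h s; rewrite /= mem_undup mem_cat sl /= => /(_ erefl) [].
  by have := h s; rewrite /= mem_undup mem_cat sl orbT /= => /(_ erefl) [].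
Qed.

Lemma cylinders_off_measurable s0 :
  cylinders_off s0 `<=` (measurable : set (set T)).
Proof.
move=> _ [l [A [_ _ mA ->]]].
apply: fin_bigcap_measurable => // s _.
by rewrite -[X in measurable X]setTI; exact: measurable_funP.
Qed.

Lemma words_off_sub s0 (B : set T) :
  measurable (B : set (words_off s0)) -> measurable B.
Proof.
apply: smallest_sub; [exact: sigma_algebra_measurable|].
exact: cylinders_off_measurable.
Qed.

Lemma measurable_words_off s0 d' (T' : measurableType d')
    (f : words_off s0 -> T') :
  measurable_fun [set: words_off s0] f -> measurable_fun [set: T] f.
Proof. by move=> mf _ B mB; apply: words_off_sub; exact: mf. Qed.

Lemma measurable_xis_off s0 s : s != [::] -> s != s0 ->
  measurable_fun [set: words_off s0] (xis s : words_off s0 -> R).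
Proof.
move=> s0nil ss0 _ B mB; rewrite setTI.
apply: sub_sigma_algebra; exists [:: s], (fun=> B); split => //.
  by move=> t; rewrite inE => /eqP ->.
apply/seteqP; split=> w /= => [h t /=|h]; first by rewrite inE => /eqP ->.
by apply: h; rewrite /= inE.
Qed.

(** In [A] both sides are finite measures, so they need only agree on the pi-system
    [cylinders_off s0]; there the product rule for the list [s0 :: l] applies. *)
Lemma words_off_indep s0 (A : set T) (B : set R) : s0 != [::] ->
  measurable (A : set (words_off s0)) -> measurable B ->
  P (A `&` xis s0 @^-1` B) = (P A * P (xis s0 @^-1` B))%E.
Proof.
move=> s0nil mA mB.
have mxB : measurable (xis s0 @^-1` B).
  by rewrite -[X in measurable X]setTI; exact: measurable_funP.
pose r := fine (P (xis s0 @^-1` B)).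
have r0 : 0 <= r by rewrite fine_ge0.
have rE : (NngNum r0)%:num%:E = P (xis s0 @^-1` B).
  by rewrite /= fineK // fin_num_measure.
suff : mrestr P mxB A = mscale (NngNum r0) P A.
  by rewrite /mrestr /mscale rE muleC.
apply: (g_sigma_algebra_measure_unique (cylinders_off s0)
  (@cylinders_off_measurable s0) (fun=> setT)).
- move=> _; exists [::], (fun=> setT); split => //.
  by apply/seteqP; split.
- by rewrite bigcup_const.
- exact: cylinders_off_setI.
- move=> _ [l [C [ul hl mC ->]]].
    suff : P ((\bigcap_(i in [set` l]) (xis i @^-1` C i)) `&` xis s0 @^-1` B) =
      (P (xis s0 @^-1` B) * P (\bigcap_(i in [set` l]) (xis i @^-1` C i)))%E.
    by rewrite -rE.
  have s0l : s0 \notin l by apply/negP => /hl[_]; rewrite eqxx.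
  pose C' s := if s == s0 then B else C s.
  have mC' s : measurable (C' s) by rewrite /C'; case: ifP.
  have := hindep (s := s0 :: l) (A := C') _ _ mC'.
  rewrite /= s0l ul => /(_ isT).
  rewrite big_cons {2}/C' eqxx.
  have -> : \bigcap_(i in [set` s0 :: l]) (xis i @^-1` C' i) =
     (\bigcap_(i in [set` l]) (xis i @^-1` C i)) `&` xis s0 @^-1` B.
    apply/seteqP; split=> w /= => [h|[h hB] i /=].
      split; last first.
        by have := h s0; rewrite /= mem_head /C' eqxx; exact.
      move=> i /= il; have := h i; rewrite /= inE il orbT /C' => /(_ isT).
      by case: eqP => // iE; rewrite iE (negbTE s0l) in il.
    rewrite inE /C'; case: eqP => [->//|_ /= il].
    exact: h.
  move=> ->; last first.
    by move=> i; rewrite inE => /orP[/eqP -> //|/hl []].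
  congr mule.
  rewrite (hindep (s := l) (A := C)) //.
    rewrite big_seq [RHS]big_seq; apply: eq_bigr => i il.
    by rewrite /C'; case: eqP il => // ->; rewrite (negbTE s0l).
  by move=> i /hl [].
- by move=> k; rewrite /= /mrestr (le_lt_trans (probability_le1 _ _)) ?ltry//;
    rewrite setTI.
- exact: mA.
Qed.

(** The identity as a random element of the coarser space: its law is the restriction of [P] to that
    sigma-algebra. *)
Let to_off s0 : T -> words_off s0 := id.

Let measurable_to_off s0 : measurable_fun [set: T] (@to_off s0).
Proof. by move=> _ B mB; rewrite setTI; exact: (@words_off_sub s0 B mB). Qed.

HB.instance Definition _ s0 :=
  isMeasurableFun.Build _ _ _ _ (@to_off s0) (@measurable_to_off s0).

(** By [words_off_indep] the joint law of [to_off s0] and [xis s0] is a product, and Tonelli's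
    theorem allows [xis s0] to be averaged separately. *)
Lemma integrate_out s0 (F : words_off s0 * R -> \bar R) : s0 != [::] ->
  measurable_fun [set: words_off s0 * R] F -> (forall z, (0 <= F z)%E) ->
  (\int[P]_w F (w : words_off s0, xis s0 w) =
   \int[P]_w \int[P0]_t F (w : words_off s0, xi t))%E.
Proof.
move=> s0nil mF F0.
pose J w := (@to_off s0 w, xis s0 w).
have mJ : measurable_fun [set: T] J.
  exact: measurable_fun_pair.
pose m1 := distribution P (@to_off s0).
pose m2 := distribution P (xis s0).
have m12 : forall X, measurable X -> (m1 \x m2)%E X = pushforward P J X.
  have := @product_measure_unique _ _ _ _ _ m1 m2
    (distribution P (mfun_Sub (mem_set mJ))).
  apply => A B mA mB.
  exact: words_off_indep.
transitivity (\int[pushforward P J]_z F z)%E.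
  by rewrite ge0_integral_pushforward.
rewrite (eq_measure_integral (m1 \x m2)%E); last first.
  by move=> X mX _; apply/esym; exact: m12.
rewrite fubini_tonelli1 // /fubini_F.
rewrite ge0_integral_distribution //=; last 2 first.
- exact: measurable_fun_fubini_tonelli_F.
- by move=> y; exact: integral_ge0.
apply: eq_integral => w _.
rewrite (eq_measure_integral (distribution P0 xi)); last first.
  by move=> X mX _; exact: hlaw.
rewrite ge0_integral_distribution //.
exact: measurableT_comp (measurable_pair1 _).
Qed.

End one_step.

(** * The killed cascade *)

Lemma sum_tuple_rcons (V : nmodType) m (F : seq bool -> V) :
  \sum_(t : m.+1.-tuple bool) F t =
  \sum_(s : m.-tuple bool) (F (rcons s true) + F (rcons s false)).
Proof.
have -> : \sum_(s : m.-tuple bool) (F (rcons s true) + F (rcons s false)) =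
    \sum_(s : m.-tuple bool) \sum_(b : bool) F (rcons s b).
  by apply: eq_bigr => s _; rewrite big_bool.
rewrite pair_big /=.
pose f (p : m.-tuple bool * bool) := [tuple of rcons p.1 p.2].
have f_inj : injective f.
  move=> [s b] [s' b'] /(congr1 val) /= /rcons_inj [/val_inj -> ->] //.
have f_bij : bijective f.
  by apply: inj_card_bij => //; rewrite card_prod !card_tuple card_bool expnSr.
by rewrite (reindex f) //=; exact: onW_bij.
Qed.

Section branching.
Context (R : realType) d (T : measurableType d) (x : seq bool -> T -> R) (a : R).

Lemma branch_sum_nil w : branch_sum x [::] w = 0.
Proof. by rewrite /branch_sum big_ord0. Qed.

Lemma branch_sum_rcons s b w :
  branch_sum x (rcons s b) w = branch_sum x s w + x (rcons s b) w.
Proof.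
rewrite /branch_sum; move: (size_rcons s b) => e.
rewrite -(big_mkord xpredT (fun k => x (take k.+1 (rcons s b)) w)) e.
rewrite big_nat_recr //= big_mkord; congr (_ + x _ w); last first.
  by rewrite -e take_size.
by apply: eq_bigr => k _; rewrite -cats1 takel_cat.
Qed.

(* [e^(X_s)], killed as soon as the branch exceeds the barrier [a]. *)
Definition killed_weight (s : seq bool) (w : T) : R :=
  \prod_(k < size s)
    (expR (x (take k.+1 s) w) * (branch_sum x (take k.+1 s) w <= a)%R%:R).

Lemma killed_weight_nil w : killed_weight [::] w = 1.
Proof. by rewrite /killed_weight big_ord0. Qed.

Lemma killed_weight_rcons s b w :
  killed_weight (rcons s b) w = killed_weight s w *
    (expR (x (rcons s b) w) * (branch_sum x (rcons s b) w <= a)%R%:R).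
Proof.
rewrite /killed_weight; move: (size_rcons s b) => e.
rewrite -(big_mkord xpredT (fun k => expR (x (take k.+1 (rcons s b)) w) *
  (branch_sum x (take k.+1 (rcons s b)) w <= a)%R%:R)) e.
rewrite big_nat_recr //= big_mkord; congr (_ * _); last first.
  by rewrite -e take_size.
by apply: eq_bigr => k _; rewrite -cats1 takel_cat.
Qed.

Lemma killed_weight_ge0 s w : 0 <= killed_weight s w.
Proof. by apply: prodr_ge0 => k _; rewrite mulr_ge0 ?expR_ge0. Qed.

Lemma killed_weight_le s w : killed_weight s w <= expR (branch_sum x s w).
Proof.
elim/last_ind: s => [|s b ih].
  by rewrite killed_weight_nil branch_sum_nil expR0.
rewrite killed_weight_rcons branch_sum_rcons expRD.
apply: ler_pM => //; first exact: killed_weight_ge0.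
by case: (_ <= a); rewrite ?mulr1 ?mulr0 ?expR_ge0.
Qed.

Lemma killed_weight_eq0 s w : 0 <= a ->
  a < branch_sum x s w -> killed_weight s w = 0.
Proof.
case/lastP: s => [|s b] a0; first by rewrite branch_sum_nil ltNge a0.
by move=> h; rewrite killed_weight_rcons leNgt h !mulr0.
Qed.

Definition below_barrier (m : nat) : set T :=
  [set w | forall s, (size s <= m)%N -> branch_sum x s w <= a].

Lemma below_barrierS m :
  below_barrier m.+1 = below_barrier m `&`
    [set w | forall s : m.-tuple bool, forall b : bool,
       branch_sum x (rcons s b) w <= a].
Proof.
apply/seteqP; split=> w /= => [h|[h1 h2] s].
  split=> [s sm|s b]; first by apply: h; exact: leqW.
  by apply: h; rewrite size_rcons size_tuple.
rewrite leq_eqVlt => /orP[/eqP|]; last exact: h1.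
case/lastP: s => [//|s b]; rewrite size_rcons => -[/eqP sm].
exact: (h2 (Tuple sm)).
Qed.

Lemma killed_weightE s w m : (size s <= m)%N -> below_barrier m w ->
  killed_weight s w = expR (branch_sum x s w).
Proof.
move=> sm h; elim/last_ind: s sm => [|s b ih] sm.
  by rewrite killed_weight_nil branch_sum_nil expR0.
rewrite killed_weight_rcons branch_sum_rcons expRD -branch_sum_rcons h //.
rewrite mulr1 ih //; apply: leq_trans sm; by rewrite size_rcons.
Qed.

(** By the many-to-one formula, the expectation summed over a generation is that of [f] along the
    tilted walk started at [a] and killed below 0. *)
Definition killed_functional (f : R -> R) (s : seq bool) (w : T) : R :=
  killed_weight s w * f (a - branch_sum x s w).

Lemma killed_functional_ge0 f s w : 0 <= a -> (forall y, 0 <= y -> 0 <= f y) ->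
  0 <= killed_functional f s w.
Proof.
move=> a0 f0; have [h|h] := ltP a (branch_sum x s w).
  by rewrite /killed_functional killed_weight_eq0 // mul0r.
by rewrite mulr_ge0 ?killed_weight_ge0 // f0 // subr_ge0.
Qed.

Lemma killed_functional_rcons f s b w : killed_functional f (rcons s b) w =
  killed_weight s w * (expR (x (rcons s b) w) *
    (x (rcons s b) w <= a - branch_sum x s w)%R%:R *
      f (a - branch_sum x s w - x (rcons s b) w)).
Proof.
rewrite /killed_functional killed_weight_rcons branch_sum_rcons.
rewrite opprD addrA -!mulrA; congr (_ * (_ * (_%:R * _))).
by rewrite lerBrDl.
Qed.

End branching.

Section killed_recursion.
Context (R : realType) d0 (T0 : measurableType d0) (P0 : probability T0 R)
  (xi : {RV P0 >-> R}) d (T : measurableType d) (P : probability T R)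
  (xis : seq bool -> {RV P >-> R})
  (hlaw : forall s : seq bool, s != [::] -> identically_distributed (xis s) xi)
  (hindep : mutually_independent [set s : seq bool | s != [::]] xis).
Context (a : R) (a0 : 0 <= a).
Local Notation X := (branch_sum xis).
Local Notation g := (killed_weight xis a).
Local Notation A := (killed_functional xis a).

(** No prefix of a word [s] that is no longer than [t] and differs from it can be [t]; hence [X s]
    does not involve [xis t]. *)
Lemma take_neq (s t : seq bool) k : (k < size s)%N -> (size s <= size t)%N ->
  s != t -> take k.+1 s != t.
Proof.
move=> ks st; apply: contra => /eqP e.
have ek : size t = k.+1 by rewrite -e size_takel.
have sk : size s = k.+1 by apply/eqP; rewrite eqn_leq ks andbT -ek.
by rewrite -e -sk take_size.
Qed.

Lemma measurable_branch_sum_off s t : (size s <= size t)%N -> s != t ->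
  measurable_fun [set: words_off xis t] (X s : words_off xis t -> R).
Proof.
move=> st nst; apply: measurable_sum => k.
apply: measurable_xis_off; last exact: take_neq.
by case: s {st nst} k => [[]|].
Qed.

Lemma measurable_le_cst d' (T' : measurableType d') (f : T' -> R) (b : R) :
  measurable_fun setT f ->
  measurable_fun setT (fun w => (f w <= b)%R%:R : R).
Proof.
move=> mf.
have -> : (fun w => (f w <= b)%R%:R : R) = \1_(f @^-1` `]-oo, b]%classic).
  apply/funext => w; rewrite indicE; congr (nat_of_bool _)%:R.
  by apply/idP/idP; rewrite inE /= in_itv.
apply: measurable_indic; rewrite -[X in measurable X]setTI; exact: mf.
Qed.

Lemma measurable_killed_weight_off s t : (size s <= size t)%N -> s != t ->
  measurable_fun [set: words_off xis t] (g s : words_off xis t -> R).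
Proof.
move=> st nst.
apply: measurable_prod => k _; apply: measurable_funM.
  apply: measurableT_comp => //.
  apply: measurable_xis_off; last exact: take_neq.
  by case: s {st nst} k => [[]|].
apply: measurable_le_cst; apply: measurable_branch_sum_off.
  by apply: leq_trans st; rewrite size_take_min geq_minr.
exact: take_neq.
Qed.

Lemma measurable_killed_functional_off f s t : measurable_fun setT f ->
  (size s <= size t)%N -> s != t ->
  measurable_fun [set: words_off xis t] (A f s : words_off xis t -> R).
Proof.
move=> mf st nst; apply: measurable_funM.
  exact: measurable_killed_weight_off.
apply: measurableT_comp => //; apply: measurable_funB => //.
exact: measurable_branch_sum_off.
Qed.

Lemma measurable_branch_sum s : measurable_fun [set: T] (X s).
Proof. by apply: measurable_sum => k. Qed.

Lemma rcons_neq (s : seq bool) b : s != rcons s b.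
Proof. by apply/eqP => /(congr1 size); rewrite size_rcons => /n_Sn. Qed.

Lemma measurable_killed_weight s : measurable_fun [set: T] (g s).
Proof.
apply: (@measurable_words_off _ _ _ _ xis (rcons s true)).
by apply: measurable_killed_weight_off; rewrite ?size_rcons ?rcons_neq.
Qed.

Lemma measurable_killed_functional f s : measurable_fun setT f ->
  measurable_fun [set: T] (A f s).
Proof.
move=> mf; apply: (@measurable_words_off _ _ _ _ xis (rcons s true)).
by apply: measurable_killed_functional_off; rewrite ?size_rcons ?rcons_neq.
Qed.

(** The past enters through the factor [H] and the scalar [Y] only, both independent of the last
    step. *)
Lemma integrate_out_last s b (H Y : words_off xis (rcons s b) -> R)
    (psi : R * R -> R) :
  measurable_fun setT H -> measurable_fun setT Y -> measurable_fun setT psi ->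
  (forall w, 0 <= H w) -> (forall z, 0 <= psi z) ->
  (\int[P]_w (H w * psi (Y w, xis (rcons s b) w))%:E =
   \int[P]_w ((H w)%:E * \int[P0]_t (psi (Y w, xi t))%:E))%E.
Proof.
move=> mH mY mpsi H0 psi0.
pose F (z : words_off xis (rcons s b) * R) := (H z.1 * psi (Y z.1, z.2))%:E.
have mF : measurable_fun setT F.
  apply/measurable_EFinP; apply: measurable_funM.
    exact: measurableT_comp mH measurable_fst.
  apply: measurableT_comp => //; apply: measurable_fun_pair => //=.
  exact: measurableT_comp mY measurable_fst.
have F0 z : (0 <= F z)%E by rewrite lee_fin mulr_ge0.
rewrite (integrate_out hlaw hindep _ mF F0); last by case: s {H Y mH mY H0 F mF F0}.
apply: eq_integral => w _.
rewrite /F /=; under eq_integral do rewrite EFinM.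
rewrite ge0_integralZl_EFin //.
- by move=> t _; rewrite lee_fin.
- apply/measurable_EFinP; apply: measurableT_comp => //.
  exact: measurable_fun_pair.
Qed.

(* Many-to-one along one edge: an inequality for the transition operator of the
   killed walk becomes one for the weights of a particle and of its child, even
   in the presence of a factor [H] independent of the step. *)
Lemma killed_step s b (H : words_off xis (rcons s b) -> R) (f rho G : R -> R)
    (lam : R) :
  measurable_fun setT H -> (forall w, 0 <= H w) -> 0 <= lam ->
  measurable_fun setT f -> measurable_fun setT rho -> measurable_fun setT G ->
  (forall y, 0 <= y -> 0 <= f y) -> (forall y, 0 <= y -> 0 <= rho y) ->
  (forall y, 0 <= y -> 0 <= G y) ->
  (forall y, 0 <= y -> ((2 * lam)%:E *
     \int[P0]_t (expR (xi t) * (xi t <= y)%R%:R * f (y - xi t))%:E +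
     (rho y)%:E <= (G y)%:E)%E) ->
  ((2 * lam)%:E * \int[P]_w (H w * A f (rcons s b) w)%:E +
    \int[P]_w (H w * A rho s w)%:E <= \int[P]_w (H w * A G s w)%:E)%E.
Proof.
move=> mH H0 lam0 mf mrho mG f0 rho0 G0 fG.
have mT (h : words_off xis (rcons s b) -> R) : measurable_fun setT h ->
  measurable_fun [set: T] h by exact: measurable_words_off.
have sz : (size s <= size (rcons s b))%N by rewrite size_rcons.
have nst := rcons_neq s b.
(* Killing is written as a comparison with the constant 0, the form covered by
   [measurable_le_cst]. *)
pose psi (z : R * R) :=
  expR z.2 * (z.2 - z.1 <= 0)%R%:R * f (z.1 - z.2).
have mpsi : measurable_fun setT psi.
  apply: measurable_funM; last first.
    by apply: measurableT_comp => //; exact: measurable_funB.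
  apply: measurable_funM; first exact: measurableT_comp measurable_snd.
  apply: measurable_le_cst; exact: measurable_funB.
have psi0 z : 0 <= psi z.
  rewrite /psi subr_le0; have [h|_] := leP z.2 z.1; last by rewrite mulr0 mul0r.
  by rewrite mulr1 mulr_ge0 ?expR_ge0 // f0 // subr_ge0.
have mg := measurable_killed_weight_off sz nst.
have mX := measurable_branch_sum_off sz nst.
have Hg0 w : 0 <= H w * g s w by rewrite mulr_ge0 ?killed_weight_ge0.
pose J w := (\int[P0]_t
      (expR (xi t) * (xi t <= a - X s w)%R%:R * f (a - X s w - xi t))%:E)%E.
have -> : (\int[P]_w (H w * A f (rcons s b) w)%:E =
    \int[P]_w ((H w * g s w)%:E * J w))%E.
  transitivity (\int[P]_w (H w * g s w *
      psi (a - X s w, xis (rcons s b) w))%:E)%E.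
    apply: eq_integral => w _.
    by rewrite killed_functional_rcons mulrA /psi /= subr_le0.
  have mHg' := measurable_funM mH mg.
  have mY := measurable_funB
    (@measurable_cst _ _ (words_off xis (rcons s b)) _ setT a) mX.
  rewrite (integrate_out_last mHg' mY mpsi Hg0 psi0).
  apply: eq_integral => w _; congr mule; apply: eq_integral => t _.
  by rewrite /psi /= subr_le0.
have J0 w : (0 <= J w)%E.
  apply: integral_ge0 => t _; rewrite lee_fin.
  by have := psi0 (a - X s w, xi t); rewrite /psi /= subr_le0.
have mJ : measurable_fun [set: T] J.
  pose F z := (psi (a - X s z.1, xi z.2))%:E.
  have mF : measurable_fun [set: T * T0] F.
    apply/measurable_EFinP; apply: measurableT_comp => //.
    apply: measurable_fun_pair => /=.
      apply: measurable_funB => //; apply: measurableT_comp measurable_fst.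
      exact: measurable_branch_sum.
    exact: measurableT_comp measurable_snd.
  have := @measurable_fun_fubini_tonelli_F _ _ _ _ _ P0 F mF.
  have -> : fubini_F P0 F = J; last by apply => z; rewrite lee_fin.
  apply/funext => w; apply: eq_integral => t _.
  by rewrite /F /psi /= subr_le0.
have mgT := mT _ mg.
have mHg : measurable_fun [set: T] (fun w => (H w * g s w)%:E).
  by apply/measurable_EFinP; apply: measurable_funM => //; exact: mT.
have HJ0 w : (0 <= (H w * g s w)%:E * J w)%E.
  by rewrite mule_ge0 ?lee_fin.
have lHJ0 w : (0 <= (2 * lam)%:E * ((H w * g s w)%:E * J w))%E.
  by rewrite mule_ge0 ?lee_fin ?mulr_ge0.
have mHJ : measurable_fun [set: T] (fun w => (H w * g s w)%:E * J w)%E.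
  exact: emeasurable_funM.
have mlHJ := measurable_funeM (2 * lam)%:E mHJ.
have HA0 h w : (forall y, 0 <= y -> 0 <= h y) -> (0 <= (H w * A h s w)%:E)%E.
  by move=> h0; rewrite lee_fin mulr_ge0 ?killed_functional_ge0.
have mHA h : measurable_fun setT h ->
    measurable_fun [set: T] (fun w => (H w * A h s w)%:E).
  move=> mh; apply/measurable_EFinP; apply: measurable_funM; first exact: mT.
  exact: measurable_killed_functional.
rewrite -ge0_integralZl_EFin //; last by rewrite mulr_ge0.
rewrite -ge0_integralD //; [|by move=> w _; exact: HA0|exact: mHA].
apply: ge0_le_integral => //.
- by move=> w _; rewrite adde_ge0 // HA0.
- by apply: emeasurable_funD => //; exact: mHA.
- exact: mHA.
move=> w _; rewrite /killed_functional.
(* Beyond the barrier all weights vanish, so [fG] is called only at a nonnegative distance. *)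
have [h|h] := ltP a (X s w).
  by rewrite killed_weight_eq0 // !mul0r !mulr0 mul0e mule0 adde0.
have := fG (a - X s w); rewrite subr_ge0 => /(_ h) {}fG.
rewrite !mulrA muleCA (EFinM _ (rho _)) -ge0_muleDr ?lee_fin //; last 2 first.
- by rewrite mule_ge0 // lee_fin mulr_ge0.
- by rewrite rho0 // subr_ge0.
by rewrite (EFinM _ (G _)) lee_wpmul2l // lee_fin.
Qed.

End killed_recursion.

(** Each child comes with the factor [2 * lam]; averaging the two bounds leaves [lam] for the pair
    and one copy of [r] and of [G]. *)
Lemma lee_halves (R : realType) (lam : R) (x y r G : \bar R) : 0 <= lam ->
  (0 <= x)%E -> (0 <= y)%E -> (0 <= r)%E ->
  ((2 * lam)%:E * x + r <= G)%E -> ((2 * lam)%:E * y + r <= G)%E ->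
  (lam%:E * (x + y) + r <= G)%E.
Proof.
move=> l0 x0 y0 r0 h1 h2.
rewrite -(@lee_pmul2l _ 2%:E) ?lte_fin //.
have dbl (z : \bar R) : (2%:E * z = z + z)%E by rewrite mule_natl mule2n.
rewrite ge0_muleDr //; last by rewrite mule_ge0 // adde_ge0.
rewrite muleA -EFinM ge0_muleDr // !dbl addeACA.
exact: leeD.
Qed.

(** At each step [lam ^+ n * v n] drops by at least [lam ^+ n * (1 - lam) * u n]. For [n < N] this
    is at least [lam ^+ N * (1 - lam) * u N], so [N] such payments fit in [v 0]. *)
Lemma geometric_budget (R : realType) (lam : R) (u v : nat -> \bar R) N :
  0 <= lam <= 1 -> (forall j, (0 <= u j)%E) -> (forall j, (0 <= v j)%E) ->
  (forall j, (u j.+1 <= u j)%E) ->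
  (forall j, (lam%:E * v j.+1 + (1 - lam)%:E * u j <= v j)%E) ->
  ((N%:R * lam ^+ N * (1 - lam))%:E * u N <= v 0%N)%E.
Proof.
move=> /andP[l0 l1] u0 v0 ud vd.
have l1' : 0 <= 1 - lam by rewrite subr_ge0.
suff H n : (n <= N)%N ->
    ((n%:R * lam ^+ N * (1 - lam))%:E * u N + (lam ^+ n)%:E * v n <= v 0%N)%E.
  apply: le_trans (H N (leqnn _)); rewrite leeDl // mule_ge0 // lee_fin.
  exact: exprn_ge0.
elim: n => [_|n ih nN]; first by rewrite !mul0r mul0e add0e expr0 mul1e.
apply: le_trans (ih (ltnW nN)).
have uN : (u N <= u n)%E.
  elim: N nN {ih} => // N ihN; rewrite ltnS leq_eqVlt => /orP[/eqP <- //|h].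
  exact: le_trans (ud _) (ihN h).
rewrite -natr1 !mulrDl mul1r EFinD ge0_muleDl ?lee_fin; last 2 first.
- by rewrite !mulr_ge0 // exprn_ge0.
- by rewrite mulr_ge0 // exprn_ge0.
rewrite -addeA; apply: leeD => //.
apply: (@le_trans _ _ ((lam ^+ n)%:E * (lam%:E * v n.+1 + (1 - lam)%:E * u n))%E);
  last by rewrite lee_wpmul2l // lee_fin exprn_ge0.
rewrite ge0_muleDr ?mule_ge0 // addeC; apply: leeD.
  by rewrite muleA -EFinM exprSr.
rewrite muleA -EFinM; apply: lee_pmul => //.
- by rewrite lee_fin mulr_ge0 // exprn_ge0.
- rewrite lee_fin ler_wpM2r //; apply: ler_wiXn2l => //; exact: ltnW.
Qed.

(** * Sums over one generation of the killed cascade *)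

Section levels.
Context (R : realType) d0 (T0 : measurableType d0) (P0 : probability T0 R)
  (xi : {RV P0 >-> R}) d (T : measurableType d) (P : probability T R)
  (xis : seq bool -> {RV P >-> R})
  (hlaw : forall s : seq bool, s != [::] -> identically_distributed (xis s) xi)
  (hindep : mutually_independent [set s : seq bool | s != [::]] xis).
Context (a : R) (a0 : 0 <= a).
Local Notation X := (branch_sum xis).
Local Notation g := (killed_weight xis a).
Local Notation A := (killed_functional xis a).

(** [D] selects ancestors of length [k], so that the descendants of fixed intervals are followed
    through later generations; [H] is a weight such as the indicator of a past event. *)
Definition level k m (D : pred (seq bool)) (H : T -> R) (f : R -> R) : \bar R :=
  (\sum_(s : m.-tuple bool | D (take k s)) \int[P]_w (H w * A f s w)%:E)%E.

Lemma level_ge0 k m D H f : (forall w, 0 <= H w) ->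
  (forall y, 0 <= y -> 0 <= f y) -> (0 <= level k m D H f)%E.
Proof.
move=> H0 f0; apply: sume_ge0 => s _; apply: integral_ge0 => w _.
by rewrite lee_fin mulr_ge0 // killed_functional_ge0.
Qed.

Lemma level_rcons k m D H f : (k <= m)%N -> level k m.+1 D H f =
  (\sum_(s : m.-tuple bool | D (take k s))
     (\int[P]_w (H w * A f (rcons s true) w)%:E +
      \int[P]_w (H w * A f (rcons s false) w)%:E))%E.
Proof.
move=> km; rewrite /level big_mkcond /=.
rewrite (@sum_tuple_rcons _ m (fun t => if D (take k t)
  then (\int[P]_w (H w * A f t w)%:E)%E else 0%E)) [RHS]big_mkcond /=.
apply: eq_bigr => s _; rewrite -!cats1 !takel_cat ?size_tuple //.
by case: ifP => // _; rewrite adde0.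
Qed.

Lemma le_level k m D (H : T -> R) (f h : R -> R) : measurable_fun [set: T] H -> (forall w, 0 <= H w) ->
  measurable_fun setT f -> measurable_fun setT h ->
  (forall y, 0 <= y -> 0 <= f y) ->
  (forall y, 0 <= y -> f y <= h y) -> (level k m D H f <= level k m D H h)%E.
Proof.
move=> mH H0 mf mh f0 fh; apply: lee_sum => s _.
have h0 y : 0 <= y -> 0 <= h y.
  by move=> y0; apply: le_trans (f0 _ y0) (fh _ y0).
apply: ge0_le_integral => //.
- by move=> w _; rewrite lee_fin mulr_ge0 // killed_functional_ge0.
- apply/measurable_EFinP; apply: measurable_funM => //.
  exact: measurable_killed_functional.
- apply/measurable_EFinP; apply: measurable_funM => //.
  exact: measurable_killed_functional.
move=> w _; rewrite lee_fin ler_wpM2l //.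
have [sa|sa] := ltP a (X s w).
  by rewrite /killed_functional killed_weight_eq0 // !mul0r.
by rewrite ler_wpM2l ?killed_weight_ge0 // fh // subr_ge0.
Qed.

Lemma levelZ k m D (H : T -> R) (f : R -> R) (c : R) : measurable_fun [set: T] H -> (forall w, 0 <= H w) ->
  measurable_fun setT f -> (forall y, 0 <= y -> 0 <= f y) -> 0 <= c ->
  level k m D H (fun y => c * f y) = (c%:E * level k m D H f)%E.
Proof.
move=> mH H0 mf f0 c0; rewrite /level ge0_sume_distrr.
  apply: eq_bigr => s _; rewrite -ge0_integralZl_EFin //.
  - by apply: eq_integral => w _; rewrite /killed_functional -EFinM; congr EFin; ring.
  - by move=> w _; rewrite lee_fin mulr_ge0 // killed_functional_ge0.
  - apply/measurable_EFinP; apply: measurable_funM => //.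
    exact: measurable_killed_functional.
move=> s _; apply: integral_ge0 => w _.
by rewrite lee_fin mulr_ge0 // killed_functional_ge0.
Qed.

(* [H] is a function of the first [m] generations. *)
Definition known_at (m : nat) (H : T -> R) :=
  forall t, (m < size t)%N -> measurable_fun [set: words_off xis t] H.

Lemma known_at_measurable m H : known_at m H -> measurable_fun [set: T] H.
Proof.
move=> /(_ (nseq m.+1 true)); rewrite size_nseq => /(_ (leqnn _)).
exact: measurable_words_off.
Qed.

Lemma known_atS m n H : (m <= n)%N -> known_at m H -> known_at n H.
Proof. by move=> mn h t nt; apply: h; apply: leq_ltn_trans nt. Qed.

(** This is [killed_step] for both children of every particle. The weight [H] has to be known at
    time [m] to be independent of the new steps. *)
Lemma level_step k m D (H : T -> R) (f rho G : R -> R) (lam : R) : (k <= m)%N ->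
  known_at m H -> (forall w, 0 <= H w) -> 0 <= lam ->
  measurable_fun setT f -> measurable_fun setT rho -> measurable_fun setT G ->
  (forall y, 0 <= y -> 0 <= f y) -> (forall y, 0 <= y -> 0 <= rho y) ->
  (forall y, 0 <= y -> 0 <= G y) ->
  (forall y, 0 <= y -> ((2 * lam)%:E *
     \int[P0]_t (expR (xi t) * (xi t <= y)%R%:R * f (y - xi t))%:E +
     (rho y)%:E <= (G y)%:E)%E) ->
  (lam%:E * level k m.+1 D H f + level k m D H rho <= level k m D H G)%E.
Proof.
move=> km mH H0 lam0 mf mrho mG f0 rho0 G0 fG.
have I0 h s : (forall y, 0 <= y -> 0 <= h y) ->
    (0 <= \int[P]_w (H w * A h s w)%:E)%E.
  move=> h0; apply: integral_ge0 => w _.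
  by rewrite lee_fin mulr_ge0 // killed_functional_ge0.
rewrite level_rcons // ge0_sume_distrr; last first.
  by move=> s _; rewrite adde_ge0 // I0.
rewrite /level -big_split; apply: lee_sum => s _.
apply: lee_halves => //; [exact: I0|exact: I0|exact: I0| |].
all: apply: (killed_step hlaw hindep) => //.
all: by apply: mH; rewrite size_rcons size_tuple.
Qed.

Context (hmass : ((2%:E * \int[P0]_t (expR (xi t))%:E <= 1)%E)).

(** Killing only lowers [2 * E e^xi], which is at most 1: the killed mass is a supermartingale. *)
Lemma level1_step k m D H : (k <= m)%N -> known_at m H -> (forall w, 0 <= H w) ->
  (level k m.+1 D H (fun=> 1%R) <= level k m D H (fun=> 1%R))%E.
Proof.
move=> km mH H0.
have -> : level k m.+1 D H (fun=> 1%R) =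
  (1%:E * level k m.+1 D H (fun=> 1%R) + level k m D H (fun=> 0%R))%E.
  rewrite mul1e [X in (_ + X)%E]big1 ?adde0 // => s _.
  by rewrite integral0_eq // => w _; rewrite /killed_functional !mulr0.
apply: level_step => // y y0.
rewrite mulr1 adde0; apply: le_trans hmass.
rewrite lee_wpmul2l //; apply: ge0_le_integral => //.
- apply/measurable_EFinP; under eq_fun do rewrite mulr1.
  apply: measurable_funM; first exact: measurableT_comp.
  exact: measurable_le_cst.
- by apply/measurable_EFinP; exact: measurableT_comp.
- move=> t _; rewrite lee_fin mulr1.
  by case: (_ <= y); rewrite ?mulr1 ?mulr0 ?expR_ge0.
Qed.

(* [U] is a supersolution for the walk that dies at rate [1 - lam]; the number
   of survivors being nonincreasing, its budget pays for [N] of them. *)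
Lemma level1_decay k m D H (U Rf : R -> R) (lam kap C : R) N : (k <= m)%N ->
  known_at m H -> (forall w, 0 <= H w) -> 0 < lam -> lam < 1 ->
  measurable_fun setT U -> measurable_fun setT Rf -> (0 < N)%N ->
  (forall y, 0 <= y -> 0 <= U y) ->
  (forall y, 0 <= y -> U y <= kap * Rf y) -> 0 <= kap ->
  (forall y, 0 <= y -> 0 <= Rf y) ->
  (forall y, 0 <= y -> ((2 * lam)%:E *
     \int[P0]_t (expR (xi t) * (xi t <= y)%R%:R * U (y - xi t))%:E +
     (1 - lam)%:E <= (U y)%:E)%E) ->
  kap * Num.sqrt N%:R <= C * (N%:R * lam ^+ N * (1 - lam)) ->
  ((Num.sqrt N%:R)%:E * level k (m + N) D H (fun=> 1%R) <=
   C%:E * level k m D H Rf)%E.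
Proof.
move=> km mH H0 l0 l1 mU mR N0 U0 UR kap0 R0 hU hC.
pose u j := level k (m + j) D H (fun=> 1%R).
pose v j := level k (m + j) D H U.
have mHT := known_at_measurable mH.
have u0 j : (0 <= u j)%E by exact: level_ge0.
have v0 j : (0 <= v j)%E by exact: level_ge0.
have b0 : (0 <= level k m D H Rf)%E by exact: level_ge0.
set Z := N%:R * lam ^+ N * (1 - lam) in hC *.
have Z0 : 0 < Z by rewrite /Z !mulr_gt0 ?ltr0n ?exprn_gt0 // subr_gt0.
have h1 : (Z%:E * u N <= v 0%N)%E.
  apply: geometric_budget => // [|j|j].
  - by rewrite !ltW.
  - rewrite /u addnS; apply: level1_step => //; first by rewrite (leq_trans km) ?leq_addr.
    by apply: known_atS mH; rewrite leq_addr.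
  - rewrite /v /u addnS.
    have -> : ((1 - lam)%:E * level k (m + j) D H (fun=> 1%R) =
        level k (m + j) D H (fun=> (1 - lam)%R))%E.
      rewrite -levelZ // ?subr_ge0 ?ltW //.
      by congr level; apply/funext => y; rewrite mulr1.
    apply: level_step => //; first by rewrite (leq_trans km) ?leq_addr.
    + by apply: known_atS mH; rewrite leq_addr.
    + exact: ltW.
    + by move=> y _; rewrite subr_ge0 ltW.
have h2 : (v 0%N <= kap%:E * level k m D H Rf)%E.
  rewrite /v addn0 -levelZ //; apply: le_level => //.
  exact: measurable_funM.
have h3 : (Z%:E * u N <= kap%:E * level k m D H Rf)%E := le_trans h1 h2.
(* Multiplying by [Z > 0] avoids a division in the extended reals; [hC] then compares the two
   constants. *)
rewrite -(@lee_pmul2l _ Z%:E) ?lte_fin //.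
rewrite muleCA; apply: (@le_trans _ _ ((Num.sqrt N%:R)%:E *
  (kap%:E * level k m D H Rf))%E).
  by rewrite lee_wpmul2l // lee_fin sqrtr_ge0.
rewrite !muleA -!EFinM lee_wpmul2r // lee_fin mulrC (mulrC Z).
exact: hC.
Qed.

(** * Second moments of the weighted sums *)

Section second_moment.
Context (Rf e : R -> R) (mR : measurable_fun setT Rf) (me : measurable_fun setT e).
Context (R0 : forall y, 0 <= y -> 0 <= Rf y) (e0 : forall y, 0 <= y -> 0 <= e y).
Context (hR : forall y, 0 <= y -> (2%:E *
     \int[P0]_t (expR (xi t) * (xi t <= y)%R%:R * Rf (y - xi t))%:E +
     (e y)%:E <= (Rf y)%:E)%E).

Definition corr s t := (\int[P]_w (A Rf s w * A Rf t w)%:E)%E.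

Lemma corrC s t : corr s t = corr t s.
Proof. by apply: eq_integral => w _; rewrite mulrC. Qed.

Lemma corr_ge0 s t : (0 <= corr s t)%E.
Proof.
by apply: integral_ge0 => w _; rewrite lee_fin mulr_ge0 // killed_functional_ge0.
Qed.

(** [A Rf t] does not see the last step of [rcons s b], so it may serve as the factor [H] in
    [killed_step] with [lam = 1]; the drift term is dropped. *)
Lemma corr_rcons s t b : (size t <= (size s).+1)%N -> t != rcons s b ->
  (2%:E * corr t (rcons s b) <= corr t s)%E.
Proof.
move=> st nst.
have := @killed_step _ _ _ _ _ _ _ _ _ hlaw hindep _ a0 s b (A Rf t) Rf e Rf 1.
rewrite mulr1 => h; apply: le_trans (h _ _ _ _ _ _ _ _ _ _) => //.
- rewrite leeDl //; apply: integral_ge0 => w _.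
  by rewrite lee_fin mulr_ge0 // killed_functional_ge0.
- by apply: measurable_killed_functional_off => //; rewrite size_rcons.
- by move=> w; exact: killed_functional_ge0.
Qed.

(* The [if] is the diagonal term, the only one that is not controlled by the
   parents. *)
Lemma corr_rcons2 s t b c : size s = size t ->
  (corr (rcons s b) (rcons t c) <= (4^-1)%:E * corr s t +
   (if rcons s b == rcons t c then corr (rcons s b) (rcons s b) else 0))%E.
Proof.
move=> st; case: eqP => [<-|/eqP n].
  by rewrite leeDr // mule_ge0 ?corr_ge0.
rewrite adde0 -(@lee_pmul2l _ 4%:E) ?lte_fin // muleA -EFinM divff ?mul1e //.
(* The two last steps are integrated out one after the other, each gaining a factor 2. *)
have h1 : (2%:E * corr (rcons s b) (rcons t c) <= corr (rcons s b) t)%E.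
  by apply: corr_rcons => //; rewrite size_rcons st.
have h2 : (2%:E * corr t (rcons s b) <= corr t s)%E.
  apply: corr_rcons => //; first by rewrite st.
  by apply/eqP => /(congr1 size); rewrite size_rcons st => /n_Sn.
rewrite (corrC s t); apply: le_trans h2; rewrite (corrC t (rcons s b)).
apply: (@le_trans _ _ (2%:E * (2%:E * corr (rcons s b) (rcons t c)))%E).
  by rewrite muleA -EFinM (_ : 2 * 2 = 4 :> R) //; ring.
by rewrite lee_wpmul2l.
Qed.

Definition pair_sum k m (D : pred (seq bool)) : \bar R :=
  (\sum_(s : m.-tuple bool | D (take k s))
     \sum_(t : m.-tuple bool | D (take k t)) corr s t)%E.

Definition square_sum k m (D : pred (seq bool)) : \bar R :=
  (\sum_(s : m.-tuple bool | D (take k s)) corr s s)%E.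

Lemma square_sum_ge0 k m D : (0 <= square_sum k m D)%E.
Proof. by apply: sume_ge0 => s _; exact: corr_ge0. Qed.

(** A pair of parents has four pairs of children, each carrying at most a quarter of its correlation
    by [corr_rcons2]; only the new diagonal is added. *)
Lemma pair_sumS k m D : (k <= m)%N ->
  (pair_sum k m.+1 D <= pair_sum k m D + square_sum k m.+1 D)%E.
Proof.
move=> km.
pose q s t : \bar R := ((4^-1)%:E * corr (take m s) (take m t))%E.
pose E s t : \bar R := (if s == t then corr s s else 0)%E.
apply: (@le_trans _ _ (\sum_(s : m.+1.-tuple bool | D (take k s))
     \sum_(t : m.+1.-tuple bool | D (take k t)) (q s t + E s t))%E).
  apply: lee_sum => s _; apply: lee_sum => t _.
  case: s => s /= /eqP ss; case: t => t /= /eqP ts; rewrite /q /E.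
  case/lastP: s ss => // s b; rewrite size_rcons => -[ss].
  case/lastP: t ts => // t c; rewrite size_rcons => -[ts].
  have es : take m (rcons s b) = s by rewrite -cats1 take_size_cat.
  have et : take m (rcons t c) = t by rewrite -cats1 take_size_cat.
  rewrite es et.
  by apply: corr_rcons2; rewrite ss ts.
under eq_bigr do rewrite big_split /=.
rewrite big_split /=; apply: leeD.
  (* Every word of length [m] has two children, with the same ancestor of length [k] since
     [k <= m]. *)
  have F1 (F : seq bool -> \bar R) :
      (\sum_(s : m.+1.-tuple bool | D (take k s)) F (take m s) =
       \sum_(s : m.-tuple bool | D (take k s)) (F s + F s))%E.
    rewrite big_mkcond /= (@sum_tuple_rcons _ m
      (fun s => if D (take k s) then F (take m s) else 0%E)).
    rewrite [RHS]big_mkcond /=; apply: eq_bigr => s _.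
    have es b : take m (rcons s b) = s by rewrite -cats1 take_size_cat ?size_tuple.
    rewrite !es -!cats1 !takel_cat ?size_tuple //.
    by case: ifP => // _; rewrite adde0.
  rewrite (F1 (fun s => \sum_(t : m.+1.-tuple bool | D (take k t))
    (4^-1)%:E * corr s (take m t))%E).
  apply: lee_sum => s _.
  rewrite (F1 (fun t => (4^-1)%:E * corr s t)%E) -big_split /=.
  apply: lee_sum => t _.
  rewrite -!ge0_muleDl ?lee_fin //.
  by rewrite -!EFinD (_ : 4^-1 + 4^-1 + (4^-1 + 4^-1) = 1 :> R) ?mul1e //; lra.
apply: lee_sum => s Ds; rewrite /E (bigD1 s) //= eqxx big1 ?adde0 //.
by move=> t /andP[_ /negbTE ts]; rewrite eq_sym -val_eqE /= in ts *; rewrite ts.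
Qed.

(** At generation [k] at most two words are selected, and [2 x y <= x^2 + y^2] reduces the
    off-diagonal terms to the diagonal. *)
Lemma pair_sum_base k (D : pred (seq bool)) : (#|[pred s : k.-tuple bool | D s]| <= 2)%N ->
  (pair_sum k k D <= 2%:E * square_sum k k D)%E.
Proof.
move=> cD.
have Dk (s : k.-tuple bool) : D (take k s) = D s.
  by rewrite take_oversize // size_tuple.
rewrite /pair_sum /square_sum.
under eq_bigl do rewrite Dk.
under eq_bigr do under eq_bigl do rewrite Dk.
under [X in (_ <= _ * X)%E]eq_bigl do rewrite Dk.
have half s t : (corr s t <= (2^-1)%:E * corr s s + (2^-1)%:E * corr t t)%E.
  have mA u : measurable_fun [set: T] (A Rf u) by exact: measurable_killed_functional.
  have A0 u w : 0 <= A Rf u w by exact: killed_functional_ge0.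
  rewrite /corr -!ge0_integralZl_EFin //; last 4 first.
  - by move=> w _; rewrite lee_fin mulr_ge0.
  - by apply/measurable_EFinP; exact: measurable_funM.
  - by move=> w _; rewrite lee_fin mulr_ge0.
  - by apply/measurable_EFinP; exact: measurable_funM.
  rewrite -ge0_integralD //; last 4 first.
  - by move=> w _; rewrite mule_ge0 // lee_fin mulr_ge0.
  - by apply: measurable_funeM; apply/measurable_EFinP; exact: measurable_funM.
  - by move=> w _; rewrite mule_ge0 // lee_fin mulr_ge0.
  - by apply: measurable_funeM; apply/measurable_EFinP; exact: measurable_funM.
  apply: ge0_le_integral => //.
  - by move=> w _; rewrite lee_fin mulr_ge0.
  - by apply/measurable_EFinP; exact: measurable_funM.
  - by apply: emeasurable_funD; apply: measurable_funeM; apply/measurable_EFinP;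
      exact: measurable_funM.
  move=> w _; rewrite -!EFinM -EFinD lee_fin.
  have := sqr_ge0 (A Rf s w - A Rf t w); rewrite expr2; nra.
set n := #|_| in cD.
set V := (\sum_(s : k.-tuple bool | D s) corr s s)%E.
have V0 : (0 <= V)%E by apply: sume_ge0 => s _; exact: corr_ge0.
have V20 : (0 <= (2^-1)%:E * V)%E by rewrite mule_ge0.
apply: (@le_trans _ _ (\sum_(s : k.-tuple bool | D s)
   \sum_(t : k.-tuple bool | D t) ((2^-1)%:E * corr s s + (2^-1)%:E * corr t t))%E).
  by apply: lee_sum => s _; apply: lee_sum => t _; exact: half.
have VE : (\sum_(t : k.-tuple bool | D t) (2^-1)%:E * corr t t =
    (2^-1)%:E * V)%E.
  by rewrite /V ge0_sume_distrr // => *; exact: corr_ge0.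
under eq_bigr do rewrite big_split /= VE.
have cst (z : \bar R) : (0 <= z)%E ->
    (\sum_(t : k.-tuple bool | D t) z <= 2%:E * z)%E.
  move=> z0; rewrite big_const -/n mule_natl mule2n.
  by case: n cD => [|[|[|//]]] _ /=; rewrite ?addr0 ?adde_ge0 ?leeDl.
rewrite big_split /=.
apply: (@le_trans _ _ (2%:E * ((2^-1)%:E * V) + 2%:E * ((2^-1)%:E * V))%E).
  apply: leeD; last exact: cst.
  rewrite {1}/V ge0_sume_distrr; last by move=> *; exact: corr_ge0.
  rewrite ge0_sume_distrr; last by move=> *; rewrite mule_ge0 // corr_ge0.
  by apply: lee_sum => s _; apply: cst; rewrite mule_ge0 // corr_ge0.
by rewrite !muleA -EFinM divff // mul1e mule_natl mule2n.
Qed.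

Lemma pair_sum_le k m (D : pred (seq bool)) : (#|[pred s : k.-tuple bool | D s]| <= 2)%N ->
  (k <= m)%N ->
  (pair_sum k m D <= 2%:E * \sum_(k <= j < m.+1) square_sum k j D)%E.
Proof.
move=> cD; elim: m => [|m ih].
  rewrite leqn0 => /eqP k0; rewrite k0 in cD *.
  by rewrite big_nat1; exact: pair_sum_base.
rewrite leq_eqVlt => /orP[/eqP <-|].
  by rewrite big_nat1; exact: pair_sum_base.
rewrite ltnS => km; rewrite big_nat_recr /=; last by rewrite ltnW.
have s0 j : (0 <= square_sum k j D)%E by exact: square_sum_ge0.
rewrite ge0_muleDr //; last by apply: sume_ge0.
apply: (le_trans (pair_sumS _ km)); apply: leeD; first exact: ih.
by rewrite mule_natl mule2n leeDl.
Qed.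

(** The inequality [hR] telescopes: each generation spends its drift out of the level sum of [Rf],
    which starts from [Rf a] at the root. *)
Lemma sum_level_le N :
  (\sum_(j < N) level 0 j predT (fun=> 1%R) e <= (Rf a)%:E)%E.
Proof.
have l0 j f : (forall y, 0 <= y -> 0 <= f y) ->
  (0 <= level 0 j predT (fun=> 1%R) f)%E by move=> f0; exact: level_ge0.
suff : (\sum_(j < N) level 0 j predT (fun=> 1%R) e +
    level 0 N predT (fun=> 1%R) Rf <= (Rf a)%:E)%E.
  by apply: le_trans; rewrite leeDl // l0.
elim: N => [|N ih].
  rewrite big_ord0 add0e /level (big_pred1 [tuple]) => [|s]; last first.
    by rewrite tuple0 /= eqxx.
  under eq_integral do rewrite mul1r /killed_functional killed_weight_nil mul1r
    branch_sum_nil subr0.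
  by rewrite integral_cst //= probability_setT mule1.
apply: le_trans ih; rewrite big_ord_recr /= -addeA leeD2l //.
rewrite addeC -[X in (X + _)%E]mul1e.
apply: level_step => // y y0; rewrite mulr1; exact: hR.
Qed.

(** One of the two weights is at most [e^(X_s) = e^a e^(-y)], and [hC] trades [e^(-y) * Rf y ^+ 2]
    for the drift. *)
Lemma square_sum_level k m D C : 0 <= C ->
  (forall y, 0 <= y -> expR (- y) * Rf y ^+ 2 <= C * e y) ->
  (square_sum k m D <= (C * expR a)%:E * level k m D (fun=> 1%R) e)%E.
Proof.
move=> C0 hC; have Ce0 : 0 <= C * expR a by rewrite mulr_ge0 ?expR_ge0.
rewrite -levelZ //; apply: lee_sum => s _.
have mA f : measurable_fun setT f -> measurable_fun [set: T] (A f s).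
  by move=> mf; exact: measurable_killed_functional.
have e0' y : 0 <= y -> 0 <= C * expR a * e y.
  by move=> /e0 ?; rewrite mulr_ge0.
apply: ge0_le_integral => //.
- by move=> w _; rewrite lee_fin mulr_ge0 // killed_functional_ge0.
- by apply/measurable_EFinP; apply: measurable_funM; exact: mA.
- apply/measurable_EFinP; apply: measurable_funM => //; apply: mA.
  exact: measurable_funM.
move=> w _; rewrite lee_fin mul1r /killed_functional.
have [h|h] := ltP a (X s w); first by rewrite killed_weight_eq0 // !mul0r.
set y := a - X s w; have y0 : 0 <= y by rewrite subr_ge0.
have gle : g s w <= expR a * expR (- y).
  by rewrite -expRD opprB addrC subrK killed_weight_le.
have g0 := killed_weight_ge0 xis a s w.
rewrite mulrACA -!mulrA ler_wpM2l // -expr2.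
apply: (@le_trans _ _ (expR a * expR (- y) * Rf y ^+ 2)).
  by rewrite ler_wpM2r ?sqr_ge0.
by rewrite -mulrA [leRHS]mulrCA ler_wpM2l ?expR_ge0 // hC.
Qed.

End second_moment.
End levels.

(** * The probability of crossing the barrier *)

Section barrier.
Context (R : realType) d0 (T0 : measurableType d0) (P0 : probability T0 R)
  (xi : {RV P0 >-> R}) d (T : measurableType d) (P : probability T R)
  (xis : seq bool -> {RV P >-> R})
  (hlaw : forall s : seq bool, s != [::] -> identically_distributed (xis s) xi)
  (hindep : mutually_independent [set s : seq bool | s != [::]] xis).
Context (a : R) (a0 : 0 <= a).
Local Notation X := (branch_sum xis).
Local Notation g := (killed_weight xis a).
Local Notation E := (below_barrier xis a).

Lemma measurable_below_barrier_off m t : (m < size t)%N ->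
  measurable (E m : set (words_off xis t)).
Proof.
elim: m => [|m ih] mt.
  rewrite (_ : E 0 = setT) //; apply/seteqP; split=> // w _ s.
  by rewrite leqn0 size_eq0 => /eqP ->; rewrite branch_sum_nil.
rewrite below_barrierS; apply: measurableI; first by apply: ih; exact: ltnW.
rewrite (_ : [set w | _] = \bigcap_(p in [set: m.-tuple bool * bool])
    (X (rcons p.1 p.2) @^-1` `]-oo, a])); last first.
  apply/seteqP; split=> w /= h.
    by move=> [s b] _ /=; rewrite in_itv /=; exact: h.
  by move=> s b; have := h (s, b) Logic.I; rewrite /= in_itv.
apply: fin_bigcap_measurable => [|[s b] _]; first exact: finite_finset.
rewrite -[X in measurable X]setTI; apply: measurable_branch_sum_off => //=.
  by rewrite size_rcons size_tuple ltnW.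
by apply: contraTneq mt => <-; rewrite size_rcons size_tuple ltnn.
Qed.

Lemma measurable_below_barrier m : measurable (E m).
Proof.
apply: (@words_off_sub _ _ _ _ xis (nseq m.+1 true)).
by apply: measurable_below_barrier_off; rewrite size_nseq.
Qed.

Context (hmass : ((2%:E * \int[P0]_t (expR (xi t))%:E <= 1)%E)).

(* The bound on [g s w] holds as soon as [s] itself is below the barrier; stated
   in this form it makes Markov's inequality immediate. *)
Definition first_crossing (s : seq bool) (b : bool) : set T :=
  [set w | a < X (rcons s b) w /\ expR a <= g s w * expR (xis (rcons s b) w)].

Lemma measurable_first_crossing s b : measurable (first_crossing s b).
Proof.
rewrite /first_crossing (_ : [set _ | _] = X (rcons s b) @^-1` `]a, +oo[ `&`
  (fun w => g s w * expR (xis (rcons s b) w)) @^-1` `[expR a, +oo[).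
  have mw : measurable_fun [set: T] (fun w => g s w * expR (xis (rcons s b) w)).
    apply: measurable_funM; first exact: measurable_killed_weight.
    exact: measurableT_comp.
  have mX := measurable_branch_sum xis (rcons s b).
  apply: measurableI; rewrite -[X in measurable X]setTI.
    by apply: mX => //; exact: measurable_itv.
  by apply: mw => //; exact: measurable_itv.
by apply/seteqP; split=> w /=; rewrite !in_itv /= !andbT.
Qed.

(** A child that crosses contributes at most [e^(-a) g(s) e^xi] by Markov's inequality, and one that
    stays below contributes exactly this; the average over the step is at most half of
    [e^(-a) g(s)]. *)
Lemma first_crossing_step s b :
  (2%:E * (P (first_crossing s b) +
     (expR (- a))%:E * \int[P]_w (g (rcons s b) w)%:E)
   <= (expR (- a))%:E * \int[P]_w (g s w)%:E)%E.
Proof.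
have mV := measurable_first_crossing s b.
have mg u : measurable_fun [set: T] (fun w => (g u w)%:E).
  by apply/measurable_EFinP; exact: measurable_killed_weight.
have g0 u w : (0 <= (g u w)%:E)%E by rewrite lee_fin killed_weight_ge0.
have mV1 : measurable_fun [set: T] (fun w => (\1_(first_crossing s b) w : R)%:E).
  by apply/measurable_EFinP; exact: measurable_indic.
have ea0 : 0 <= expR (- a) by exact: expR_ge0.
have ge0 w : (0 <= (expR (- a))%:E * (g (rcons s b) w)%:E)%E.
  by rewrite mule_ge0.
rewrite -[in P _](setIT (first_crossing s b)) -integral_indic //.
rewrite -!ge0_integralZl_EFin // -ge0_integralD //; last exact: measurable_funeM.
apply: (@le_trans _ _ (2%:E * \int[P]_w (g s w * (expR (- a) *
    expR (xis (rcons s b) w)))%:E)%E).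
  rewrite lee_wpmul2l //; apply: ge0_le_integral => //.
  - by move=> w _; rewrite adde_ge0 // lee_fin.
  - by apply: emeasurable_funD => //; exact: measurable_funeM.
  - apply/measurable_EFinP; apply: measurable_funM.
      exact: measurable_killed_weight.
    by apply: measurable_funM => //; exact: measurableT_comp.
  move=> w _; rewrite -EFinM -EFinD lee_fin killed_weight_rcons indicE.
  have [h|h] := leP (X (rcons s b) w) a.
    rewrite mulr1 memNset ?add0r; first by rewrite mulrCA.
    by case=> /=; rewrite ltNge h.
  rewrite !mulr0 addr0 mulrCA.
  case: (boolP (w \in _)); last by rewrite !mulr_ge0 ?expR_ge0 ?killed_weight_ge0.
  rewrite inE => -[_] /= hw.
  by rewrite expRN ler_pdivlMl ?expR_gt0 // mulr1.
pose psi (z : R * R) := expR (- a) * expR z.2.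
have mpsi : measurable_fun setT psi.
  by apply: measurable_funM => //; exact: measurableT_comp measurable_snd.
have psi0 z : 0 <= psi z by rewrite mulr_ge0 ?expR_ge0.
have mH : measurable_fun [set: words_off xis (rcons s b)]
    (g s : words_off xis (rcons s b) -> R).
  by apply: measurable_killed_weight_off; rewrite ?size_rcons ?rcons_neq.
have mY := @measurable_cst _ _ (words_off xis (rcons s b)) _ setT (0 : R).
have -> : (\int[P]_w (g s w * (expR (- a) * expR (xis (rcons s b) w)))%:E =
    \int[P]_w ((g s w)%:E * \int[P0]_t (expR (- a) * expR (xi t))%:E))%E.
  exact: (integrate_out_last hlaw hindep mH mY mpsi
    (killed_weight_ge0 xis a s) psi0).
under [X in (_ * X)%E]eq_integral do rewrite muleC.
have I0 : (0 <= \int[P0]_t (expR (xi t))%:E)%E.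
  by apply: integral_ge0 => t _; rewrite lee_fin expR_ge0.
have -> : (\int[P0]_t (expR (- a) * expR (xi t))%:E =
    (expR (- a))%:E * \int[P0]_t (expR (xi t))%:E)%E.
  rewrite -ge0_integralZl_EFin //.
  by apply/measurable_EFinP; exact: measurableT_comp.
rewrite ge0_integralZl ?mule_ge0 // muleA muleCA -muleA.
rewrite ge0_integralZl_EFin // lee_wpmul2l //.
by rewrite -[leRHS]mul1e lee_wpmul2r // integral_ge0.
Qed.

(** As long as generation [m] is below the barrier no weight has been killed, so a child above [a]
    has its parent's full weight behind it. *)
Lemma not_below_barrierS m : ~` E m.+1 `<=`
  ~` E m `|` [set w | exists (s : m.-tuple bool) b, first_crossing s b w].
Proof.
move=> w; rewrite below_barrierS setCI => -[h|h]; first by left.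
have [h1|h1] := pselect (E m w); last by left.
right; apply: contrapT => h2; apply: h => s b; rewrite leNgt; apply/negP => h.
apply: h2; exists s, b; split => //.
rewrite (@killed_weightE _ _ _ _ _ _ _ m) ?size_tuple // -expRD.
by rewrite -branch_sum_rcons ler_expR ltW.
Qed.

(** The left side does not increase with [m]: by [first_crossing_step], the probability of new
    crossings is paid out of the surviving mass. At [m = 0] it equals [e^(-a)]. *)
Lemma barrier_budget m :
  (P (~` E m) + (expR (- a))%:E * \sum_(s : m.-tuple bool) \int[P]_w (g s w)%:E
    <= (expR (- a))%:E)%E.
Proof.
have ea0 : 0 <= expR (- a) by exact: expR_ge0.
have I0 s : (0 <= \int[P]_w (g s w)%:E)%E.
  by apply: integral_ge0 => w _; rewrite lee_fin killed_weight_ge0.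
elim: m => [|m ih].
  rewrite (_ : ~` E 0 = set0); last first.
    rewrite -setCT; congr (~` _); apply/seteqP; split=> // w _ s.
    by rewrite leqn0 size_eq0 => /eqP ->; rewrite branch_sum_nil.
  rewrite measure0 add0e (big_pred1 [tuple]) => [|s]; last first.
    by apply/esym/eqP; exact: tuple0.
  under eq_integral do rewrite killed_weight_nil.
  by rewrite integral_cst //= probability_setT mule1 mule1.
apply: le_trans ih.
pose v s := (P (first_crossing s true) + P (first_crossing s false))%E.
have h1 : (P (~` E m.+1) <= P (~` E m) + \sum_(s : m.-tuple bool) v s)%E.
  have mE k : measurable (~` E k) by apply: measurableC; exact: measurable_below_barrier.
  pose f s w : \bar R := ((\1_(first_crossing s true) w)%:E +
     (\1_(first_crossing s false) w)%:E)%E.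
  have mi s b : measurable_fun [set: T] (fun w => (\1_(first_crossing s b) w : R)%:E).
    by apply/measurable_EFinP; exact/measurable_indic/measurable_first_crossing.
  have mf s : measurable_fun [set: T] (f s) by exact: emeasurable_funD.
  have f0 s w : (0 <= f s w)%E by rewrite adde_ge0.
  have vE s : v s = (\int[P]_w f s w)%E.
    rewrite ge0_integralD // !integral_indic ?setIT //;
      exact: measurable_first_crossing.
  rewrite -(setIT (~` E m.+1)) -(setIT (~` E m)) -!integral_indic //.
  under eq_bigr do rewrite vE.
  rewrite -ge0_integral_sum // -ge0_integralD //; last 3 first.
  - by apply/measurable_EFinP; exact: measurable_indic.
  - by move=> w _; exact: sume_ge0.
  - exact: emeasurable_sum.
  apply: ge0_le_integral => //.
  - by apply/measurable_EFinP; exact: measurable_indic.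
  - apply: emeasurable_funD; last exact: emeasurable_sum.
    by apply/measurable_EFinP; exact: measurable_indic.
  move=> w _; rewrite [in leLHS]indicE.
  case: (boolP (w \in _)) => [|_]; last by rewrite adde_ge0 // sume_ge0.
  rewrite inE => /not_below_barrierS [h|[s [b h]]].
    by rewrite indicE mem_set // leeDl // sume_ge0.
  apply: (@le_trans _ _ (f s w)).
    rewrite /f; case: b h => h.
      by rewrite [X in (_ <= X%:E + _)%E]indicE mem_set //= leeDl.
    by rewrite [X in (_ <= _ + X%:E)%E]indicE mem_set //= leeDr.
  rewrite (bigD1 s) //= addeCA leeDl // adde_ge0 // sume_ge0 //.
apply: (le_trans (leeD2r _ h1)); rewrite -addeA leeD2l //.
rewrite (@sum_tuple_rcons _ m (fun s => \int[P]_w (g s w)%:E)%E).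
rewrite !ge0_sume_distrr //; last by move=> s _; exact: adde_ge0.
rewrite -big_split /=; apply: lee_sum => s _.
rewrite ge0_muleDr // addeACA.
have dbl (u : \bar R) : (2%:E * u = u + u)%E by rewrite mule_natl mule2n.
rewrite -(@lee_pmul2l _ 2%:E) ?lte_fin // ge0_muleDr.
- by rewrite [leRHS]dbl; apply: leeD; exact: first_crossing_step.
- by rewrite adde_ge0 // mule_ge0.
- by rewrite adde_ge0 // mule_ge0.
Qed.

Lemma barrier_prob m : (P (~` E m) <= (expR (- a))%:E)%E.
Proof.
apply: le_trans (barrier_budget m); rewrite leeDl // mule_ge0 ?lee_fin ?expR_ge0//.
by apply: sume_ge0 => s _; apply: integral_ge0 => w _; rewrite lee_fin killed_weight_ge0.
Qed.

Definition below_forever : set T := \bigcap_m E m.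

Lemma measurable_below_forever : measurable below_forever.
Proof. by apply: bigcapT_measurable => m; exact: measurable_below_barrier. Qed.

Lemma below_barrier_nonincreasing : nonincreasing_seq E.
Proof.
move=> m n mn; apply/subsetPset => w h s sm; apply: h; exact: leq_trans mn.
Qed.

(** Continuity from above. It lets [below_forever], which depends on all generations, be exchanged
    at small cost for an event of the first [m]. *)
Lemma below_barrier_cvg : P (E m `\` below_forever) @[m --> \oo] --> 0%E.
Proof.
have mF := measurable_below_forever.
have mE := measurable_below_barrier.
rewrite -(measure0 P) (_ : set0 = \bigcap_m (E m `\` below_forever)).
  apply: nonincreasing_cvg_mu => //.
  - by rewrite (le_lt_trans (probability_le1 _ _)) ?ltry //; exact: measurableD.
  - by move=> m; exact: measurableD.
  - by apply: bigcapT_measurable => m; exact: measurableD.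
  - move=> m n mn; apply/subsetPset; apply: setSD.
    exact/subsetPset/below_barrier_nonincreasing.
apply/seteqP; split=> // w /= h; have [_ nF] := h 0%N Logic.I.
by apply: nF => m _; have [] := h m Logic.I.
Qed.

Lemma below_forever_prob : (P (~` below_forever) <= (expR (- a))%:E)%E.
Proof.
rewrite setC_bigcap.
have mE m : measurable (~` E m) by apply: measurableC; exact: measurable_below_barrier.
have h : P (~` E m) @[m --> \oo] --> P (\bigcup_m ~` E m).
  apply: nondecreasing_cvg_mu => //; first exact: bigcupT_measurable.
  move=> m n mn; apply/subsetPset; apply: subsetC.
  exact/subsetPset/below_barrier_nonincreasing.
rewrite -(cvg_lim _ h) //; apply: lime_le; first exact: cvgP h.
by apply: nearW => m; exact: barrier_prob.
Qed.

End barrier.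

(** * Functions of the tilted walk *)

(** For [th * x >= -2], square [1 + th x / 2 <= e^(th x / 2)]. Otherwise the linear branch of the
    minimum, with [th <= 1], makes the left side at most [1 + th x / 2 < 0]. *)
Lemma expR_quadratic (R : realType) (th x : R) : 0 <= th <= 1 ->
  1 + th * x + th ^+ 2 * Num.min (x ^+ 2 / 4) (`|x| / 2) <= expR (th * x).
Proof.
move=> /andP[t0 t1]; have [h|h] := leP (- 2) (th * x).
  have h1 : 0 <= 1 + th * x / 2 by lra.
  have h2 : 1 + th * x / 2 <= expR (th * x / 2) by exact: expR_ge1Dx.
  have -> : expR (th * x) = expR (th * x / 2) ^+ 2.
    by rewrite expr2 -expRD; congr expR; lra.
  have h3 : (1 + th * x / 2) ^+ 2 <= expR (th * x / 2) ^+ 2.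
    by rewrite ler_sqr // nnegrE ?expR_ge0.
  apply: le_trans h3.
  have : th ^+ 2 * Num.min (x ^+ 2 / 4) (`|x| / 2) <= th ^+ 2 * (x ^+ 2 / 4).
    by rewrite ler_wpM2l ?sqr_ge0 // ge_min lexx.
  rewrite !expr2; lra.
have x0 : x < 0 by nra.
have : th ^+ 2 * Num.min (x ^+ 2 / 4) (`|x| / 2) <= th ^+ 2 * (`|x| / 2).
  by rewrite ler_wpM2l ?sqr_ge0 // ge_min lexx orbT.
rewrite ltr0_norm // => h1.
have h2 : th ^+ 2 * (- x / 2) <= th * (- x / 2).
  by rewrite ler_wpM2r ?expr2; nra.
have := expR_ge0 (th * x); lra.
Qed.

Section tilted_walk.
Context (R : realType) d0 (T0 : measurableType d0) (P0 : probability T0 R)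
  (xi : {RV P0 >-> R}).
Context (hmean : ('E_P0[fun t => expR (xi t)] = (2^-1)%:E)%E)
  (hcrit : ('E_P0[fun t => (xi t * expR (xi t))%R] = 0)%E)
  (h : R) (h0 : 0 < h)
  (hmoment : ('E_P0[fun t => expR ((1 + h) * xi t)%R] < +oo)%E).

(* The step law of the random walk of the many-to-one formula: [2 e^x] times
   the law of [xi], a centred probability. *)
Definition tilted (f : R -> R) : R :=
  (\int[P0]_t (2 * expR (xi t) * f (xi t))).

Definition tiltable (f : R -> R) :=
  P0.-integrable setT (fun t => (2 * expR (xi t) * f (xi t))%:E).

Lemma tiltable_dominated f g : measurable_fun setT f ->
  (forall x, `|expR x * f x| <= g x) ->
  P0.-integrable setT (fun t => (g (xi t))%:E) -> tiltable f.
Proof.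
move=> mf fg ig.
have := integrableZl measurableT 2 ig; apply: le_integrable => //.
  apply/measurable_EFinP; apply: measurable_funM; last exact: measurableT_comp.
  by apply: measurable_funM => //; exact: measurableT_comp.
move=> t _; rewrite -EFinM lee_fin -mulrA !(normrM 2) ler_wpM2l //.
exact: le_trans (fg _) (ler_norm _).
Qed.

Lemma expR_integrable :
  P0.-integrable setT (fun t => (expR (xi t))%:E).
Proof.
apply/integrableP; split.
  by apply/measurable_EFinP; exact: measurableT_comp.
move: hmean; rewrite unlock => hm.
by under eq_integral do rewrite gee0_abs ?lee_fin ?expR_ge0 //; rewrite hm ltry.
Qed.

Lemma expRh_integrable :
  P0.-integrable setT (fun t => (expR ((1 + h) * xi t))%:E).
Proof.
apply/integrableP; split.
  apply/measurable_EFinP; apply: measurableT_comp => //.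
  exact: measurable_funM.
move: hmoment; rewrite unlock => hm.
by under eq_integral do rewrite gee0_abs ?lee_fin ?expR_ge0 //.
Qed.

Lemma tiltable_exp th : 0 <= th <= h -> tiltable (fun x => expR (th * x)).
Proof.
move=> /andP[t0 th1].
(* The second exponential dominates for [x >= 0], the first for [x < 0]. *)
apply: (@tiltable_dominated _ (fun x => expR x + expR ((1 + h) * x))).
- by apply: measurableT_comp => //; exact: measurable_funM.
- move=> x; rewrite ger0_norm ?mulr_ge0 ?expR_ge0 // -expRD.
  have [x0|x0] := leP 0 x.
    by rewrite -[leLHS]add0r lerD ?expR_ge0 // ler_expR; nra.
  by rewrite -[leLHS]addr0 lerD ?expR_ge0 // ler_expR; nra.
have := integrableD measurableT expR_integrable expRh_integrable.
by apply: eq_integrable => // t _; rewrite EFinD.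
Qed.

Lemma tiltable_cst (c : R) : tiltable (fun=> c).
Proof.
have := integrableZl measurableT (2 * c) expR_integrable.
by apply: eq_integrable => // t _; rewrite -EFinM; congr EFin; ring.
Qed.

Lemma tiltable_id : tiltable id.
Proof.
(* For [x >= 0] use [h x <= e^(h x)]; for [x < 0] use [- x e^x <= 1]. *)
apply: (@tiltable_dominated _ (fun x => 1 + h^-1 * expR ((1 + h) * x))) => //.
- move=> x; have ih0 : 0 < h^-1 by rewrite invr_gt0.
  have [x0|x0] := leP 0 x.
    rewrite ger0_norm ?mulr_ge0 ?expR_ge0 //.
    rewrite mulrDl mul1r expRD -[leLHS]add0r lerD // mulrCA ler_wpM2l ?expR_ge0//.
    by rewrite ler_pdivlMl // (le_trans _ (expR_ge1Dx _)) // lerDr.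
  rewrite ler0_norm; last by rewrite mulr_ge0_le0 ?expR_ge0 // ltW.
  rewrite -[leLHS]addr0 lerD //; last by rewrite mulr_ge0 ?expR_ge0 ?ltW.
  rewrite -mulrN -ler_pdivlMl ?expR_gt0 // mulr1 -expRN.
  by apply: le_trans (expR_ge1Dx _); rewrite lerDr.
have := integrableZl measurableT h^-1 expRh_integrable.
move/(integrableD measurableT (finite_measure_integrable_cst P0 1 measurableT)).
by apply: eq_integrable => // t _; rewrite EFinD.
Qed.

Lemma tiltableZ c f : tiltable f -> tiltable (fun x => c * f x).
Proof.
move=> /(integrableZl measurableT c); apply: eq_integrable => // t _.
by rewrite -EFinM; congr EFin; ring.
Qed.

Lemma tiltableD f g : tiltable f -> tiltable g -> tiltable (fun x => f x + g x).
Proof.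
move=> tf tg; have := integrableD measurableT tf tg.
by apply: eq_integrable => // t _; rewrite -EFinD; congr EFin; ring.
Qed.

Lemma tiltedZ c f : tiltable f -> tilted (fun x => c * f x) = c * tilted f.
Proof.
move=> tf; rewrite /tilted -RintegralZl //.
by apply: eq_Rintegral => t _; ring.
Qed.

Lemma tiltedD f g : tiltable f -> tiltable g ->
  tilted (fun x => f x + g x) = tilted f + tilted g.
Proof.
move=> tf tg; rewrite /tilted -RintegralD //.
by apply: eq_Rintegral => t _; ring.
Qed.

Lemma le_tilted f g : tiltable f -> tiltable g -> (forall x, f x <= g x) ->
  tilted f <= tilted g.
Proof.
move=> tf tg fg; apply: le_Rintegral => // t _.
by rewrite ler_wpM2l // mulr_ge0 // expR_ge0.
Qed.

Lemma tilted_cst c : tilted (fun=> c) = c.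
Proof.
rewrite /tilted.
under eq_Rintegral do rewrite mulrC mulrA.
rewrite RintegralZl //; last exact: expR_integrable.
move: hmean; rewrite /Rintegral unlock => -> /=; lra.
Qed.

Lemma tilted_id : tilted id = 0.
Proof.
rewrite /tilted; under eq_Rintegral do rewrite -mulrA (mulrC (expR _)).
rewrite RintegralZl //.
  by move: hcrit; rewrite /Rintegral unlock => -> /=; rewrite mulr0.
have := integrableZl measurableT 2^-1 tiltable_id.
by apply: eq_integrable => // t _ /=; rewrite -EFinM; congr EFin; field.
Qed.

Definition laplace th := tilted (fun x => expR (th * x)).

(** A substitute for the variance of the tilted step, up to a constant; its linear growth makes it
    integrable by [tiltable_id]. *)
Definition curvature := tilted (fun x => Num.min (x ^+ 2 / 4) (`|x| / 2)).

Lemma measurable_curvature :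
  measurable_fun [set: R] (fun x : R => Num.min (x ^+ 2 / 4) (`|x| / 2)).
Proof.
by apply: measurable_minr; exact: measurable_funM.
Qed.

Lemma curvature_ge0 (x : R) : 0 <= Num.min (x ^+ 2 / 4) (`|x| / 2).
Proof. by rewrite le_min !divr_ge0 ?sqr_ge0. Qed.

Lemma tiltable_curvature :
  tiltable (fun x => Num.min (x ^+ 2 / 4) (`|x| / 2)).
Proof.
have := tiltable_id; apply: le_integrable => //.
  apply/measurable_EFinP; apply: measurable_funM.
    by apply: measurable_funM => //; exact: measurableT_comp.
  exact: measurableT_comp measurable_curvature _.
move=> t _; rewrite lee_fin !normrM ler_wpM2l ?mulr_ge0 //.
rewrite ger0_norm ?curvature_ge0 // ge_min; apply/orP; right.
by rewrite ler_pdivrMr // ler_peMr // ler1n.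
Qed.

(** Integrate [expR_quadratic] against the tilted law: the mean vanishes and the quadratic gain
    remains. *)
Lemma laplace_ge th : 0 <= th -> th <= h -> th <= 1 ->
  1 + curvature * th ^+ 2 <= laplace th.
Proof.
move=> t0 t1 t2.
have -> : 1 + curvature * th ^+ 2 =
    tilted (fun x => 1 + th * x + th ^+ 2 * Num.min (x ^+ 2 / 4) (`|x| / 2)).
  have tZ := tiltableZ th tiltable_id.
  have tC := tiltableZ (th ^+ 2) tiltable_curvature.
  rewrite (tiltedD (tiltableD (tiltable_cst 1) tZ) tC).
  rewrite (tiltedD (tiltable_cst 1) tZ) tilted_cst.
  rewrite (tiltedZ _ tiltable_id) tilted_id (tiltedZ _ tiltable_curvature).
  by rewrite mulr0 addr0 mulrC.
apply: le_tilted.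
- apply: tiltableD; last exact: tiltableZ tiltable_curvature.
  exact: tiltableD (tiltable_cst 1) (tiltableZ th tiltable_id).
- by apply: tiltable_exp; rewrite t0.
- by move=> x; apply: expR_quadratic; rewrite t0.
Qed.

(* If the curvature vanished then [xi] would be null almost surely, against
   [E e^xi = 1/2]. *)
Lemma curvature_gt0 : 0 < curvature.
Proof.
pose f t := 2 * expR (xi t) * Num.min (xi t ^+ 2 / 4) (`|xi t| / 2).
have f0 t : 0 <= f t by rewrite !mulr_ge0 ?expR_ge0 ?curvature_ge0.
rewrite lt_neqAle; apply/andP; split; last by apply: Rintegral_ge0 => t _; exact: f0.
apply/eqP => c0.
have mf : measurable_fun setT (EFin \o f) by case/integrableP: tiltable_curvature.
have I0 : (\int[P0]_t `|(f t)%:E| = 0)%E.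
  under eq_integral do rewrite gee0_abs ?lee_fin //.
  move: c0; rewrite /curvature /tilted /Rintegral => /esym/eqP.
  rewrite fine_eq0; last exact: (integrable_fin_num measurableT tiltable_curvature).
  by move/eqP.
have /(ae_eq_integral_abs P0 measurableT mf) ae0 := I0.
have : (\int[P0]_t (expR (xi t))%:E = \int[P0]_t 1%:E)%E.
  apply: ae_eq_integral => //.
    by apply/measurable_EFinP; exact: measurableT_comp.
  apply: filterS ae0 => t /(_ Logic.I) [ft] _; congr EFin.
  have /eqP := ft; rewrite /f mulf_eq0 mulf_eq0 pnatr_eq0 expR_eq0 /=.
  have [->|x0] := eqVneq (xi t) 0; first by rewrite expR0.
  rewrite gt_eqF // lt_min; apply/andP; split.
    by rewrite mulr_gt0 ?invr_gt0 // exprn_even_gt0.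
  by rewrite mulr_gt0 ?invr_gt0 // normr_gt0.
move: hmean; rewrite unlock => ->.
rewrite integral_cst //= probability_setT mule1 => -[] /eqP.
by rewrite invr_eq1 -subr_eq0 (_ : 2 - 1 = 1 :> R) ?oner_eq0 //; ring.
Qed.

Lemma tilted_mass : (2%:E * \int[P0]_t (expR (xi t))%:E <= 1)%E.
Proof. by move: hmean; rewrite unlock => ->; rewrite -EFinM divff. Qed.

(** A majorant on the survivors that stays nonnegative on the killed steps turns the truncated
    integral into a full one, computable by Laplace transforms. *)
Lemma killed_tilt_le (f B : R -> R) (y : R) : measurable_fun setT f ->
  (forall z, 0 <= z -> 0 <= f z) -> tiltable B ->
  (forall x, x <= y -> f (y - x) <= B x) -> (forall x, y < x -> 0 <= B x) ->
  (2%:E * \int[P0]_t (expR (xi t) * (xi t <= y)%R%:R * f (y - xi t))%:E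
   <= (tilted B)%:E)%E.
Proof.
move=> mf f0 tB fB B0.
rewrite /tilted /Rintegral fineK; last exact: integrable_fin_num.
have pos t : 0 <= expR (xi t) * (xi t <= y)%R%:R * f (y - xi t).
  have [xy|_] := leP (xi t) y; last by rewrite mulr0 mul0r.
  by rewrite mulr1 mulr_ge0 ?expR_ge0 // f0 // subr_ge0.
have mI : measurable_fun setT
    (fun t => (expR (xi t) * (xi t <= y)%R%:R * f (y - xi t))%:E).
  apply/measurable_EFinP; apply: measurable_funM.
    apply: measurable_funM; first exact: measurableT_comp.
    exact: measurable_le_cst.
  by apply: measurableT_comp => //; exact: measurable_funB.
rewrite -ge0_integralZl_EFin //; last by move=> t _; rewrite lee_fin.
apply: ge0_le_integral => //.
- by move=> t _; rewrite mule_ge0 // lee_fin.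
- exact: measurable_funeM.
- by case/integrableP: tB.
move=> t _; rewrite -EFinM lee_fin -!mulrA ler_wpM2l // ler_wpM2l ?expR_ge0 //.
have [xy|xy] := leP (xi t) y; first by rewrite mul1r fB.
by rewrite mul0r B0.
Qed.

(** The form of the majorants used for [Rf] and [U]; the linear term drops out because the tilted
    law is centred. *)
Lemma tilted_combination a0 a1 a2 a3 a4 u v w : 0 <= u <= h -> 0 <= v <= h ->
  0 <= w <= h ->
  let B x := a0 + a1 * x + a2 * expR (u * x) + a3 * expR (v * x)
             + a4 * expR (w * x) in
  tiltable B /\ tilted B = a0 + a2 * laplace u + a3 * laplace v + a4 * laplace w.
Proof.
move=> hu hv hw /=.
have t0 := tiltable_cst a0.
have t1 := tiltableZ a1 tiltable_id.
have t2 := tiltableZ a2 (tiltable_exp hu).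
have t3 := tiltableZ a3 (tiltable_exp hv).
have t4 := tiltableZ a4 (tiltable_exp hw).
have t01 := tiltableD t0 t1; have t02 := tiltableD t01 t2.
have t03 := tiltableD t02 t3; have t04 := tiltableD t03 t4.
split => //.
rewrite (tiltedD t03 t4) (tiltedD t02 t3) (tiltedD t01 t2) (tiltedD t0 t1).
rewrite (tiltedZ _ tiltable_id) tilted_id tilted_cst mulr0 addr0.
rewrite (tiltedZ _ (tiltable_exp hu)) (tiltedZ _ (tiltable_exp hv)).
by rewrite (tiltedZ _ (tiltable_exp hw)).
Qed.

(** [Rf] and [e] serve the second moment. For each horizon [N], the supersolution [U] serves
    [level1_decay], with [1 - lam] of order [1 / N] and [kap] of order [N^(-1/2)]; one [C] works for
    all [N]. *)
Lemma walk_functions : exists (Rf e : R -> R) (C : R),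
  [/\ measurable_fun setT Rf /\ measurable_fun setT e,
      (forall y, 0 <= y -> 0 <= Rf y) /\ (forall y, 0 <= y -> 0 <= e y),
      (forall y, 0 <= y -> (2%:E *
         \int[P0]_t (expR (xi t) * (xi t <= y)%R%:R * Rf (y - xi t))%:E +
         (e y)%:E <= (Rf y)%:E)%E),
      0 <= C /\ (forall y, 0 <= y -> expR (- y) * Rf y ^+ 2 <= C * e y) &
      forall N, (0 < N)%N -> exists (U : R -> R) (lam kap : R),
        [/\ 0 < lam < 1 /\ 0 <= kap, measurable_fun setT U,
            forall y, 0 <= y -> 0 <= U y <= kap * Rf y,
            (forall y, 0 <= y -> ((2 * lam)%:E *
              \int[P0]_t (expR (xi t) * (xi t <= y)%R%:R * U (y - xi t))%:E +
              (1 - lam)%:E <= (U y)%:E)%E) &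
            kap * Num.sqrt N%:R <= C * (N%:R * lam ^+ N * (1 - lam))]].
Proof.
(* [2 * dl <= h] makes [laplace (2 * dl)] finite; [dl <= 1 / 2] gives [e^(-y / 2) <= e^(-dl y)]
   below. *)
pose dl := Num.min h 1 / 2.
have m0 : 0 < Num.min h 1 by rewrite lt_min h0 ltr01.
have dl0 : 0 < dl by rewrite divr_gt0.
have mh : Num.min h 1 <= h by rewrite ge_min lexx.
have m1 : Num.min h 1 <= 1 by rewrite ge_min lexx orbT.
have dlh : 2 * dl <= h by rewrite /dl; lra.
have dl1 : dl <= 1 / 2 by rewrite /dl; lra.
clearbody dl; clear m0 mh m1.
set c := curvature; have c0 : 0 < c := curvature_gt0.
pose p1 := laplace dl; pose p2 := laplace (2 * dl).
have hp1 : 1 + c * dl ^+ 2 <= p1 by apply: laplace_ge; lra.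
have p11 : 0 < p1 - 1.
  have : 0 < c * dl ^+ 2 by rewrite mulr_gt0 // exprn_gt0.
  lra.
have p20 : 0 < p2.
  have : 1 + c * (2 * dl) ^+ 2 <= p2 by apply: laplace_ge; lra.
  have : 0 <= c * (2 * dl) ^+ 2 by rewrite mulr_ge0 ?sqr_ge0 // ltW.
  lra.
(* The correction for overshoot then consumes exactly half of the drift [p1 - 1]; the other half is
   [c1]. *)
pose ep := (p1 - 1) / (2 * p2).
have ep0 : 0 < ep by rewrite divr_gt0 // mulr_gt0.
have epE' : ep * p2 = (p1 - 1) / 2 by rewrite /ep; field; lra.
clearbody ep.
pose C2 := 1 + dl^-1.
(* [K >= 1] gives [Rf y >= y]; the second bound makes [ep q^2 - C2 q + K] nonnegative for every
   [q]. *)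
pose K := Num.max 1 (C2 ^+ 2 / (4 * ep)).
have K1 : 1 <= K by rewrite le_max lexx.
have K2 : C2 ^+ 2 / (4 * ep) <= K by rewrite le_max lexx orbT.
clearbody K.
pose c1 := (p1 - 1) / 2.
have c10 : 0 < c1 by rewrite divr_gt0.
have c1E : c1 = (p1 - 1) / 2 by [].
clearbody c1.
pose Rf y := y + K - expR (- (dl * y)).
pose e y := c1 * expR (- (dl * y)).
have Ry y : 0 <= y -> y <= Rf y.
  move=> y0; rewrite /Rf -addrA lerDl subr_ge0 (le_trans _ K1) //.
  by rewrite expR_le1 oppr_le0 mulr_ge0 // ltW.
have R0 y : 0 <= y -> 0 <= Rf y by move=> y0; apply: le_trans (Ry _ y0).
have mlin th : measurable_fun [set: R] (fun y : R => expR (- (th * y))).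
  under eq_fun do rewrite -mulNr.
  by apply: measurableT_comp => //; exact: measurable_funM.
have mR : measurable_fun setT Rf.
  by apply: measurable_funB => //; exact: measurable_funD.
(* On killed steps, with overshoot [z], both [z] and [e^(dl z)] are at most multiples of
   [q = e^(dl z)], while the correction is at least [ep q^2]. *)
have over y x : 0 <= y -> y < x ->
    0 <= y + K - x - expR (- (dl * y)) * expR (dl * x)
      + ep * expR (- (dl * y)) * expR (2 * dl * x).
  move=> y0 yx; set z := x - y; have z0 : 0 < z by rewrite subr_gt0.
  have E1 : expR (- (dl * y)) * expR (dl * x) = expR (dl * z).
    by rewrite -expRD; congr expR; rewrite /z; ring.
  have E2 : expR (- (dl * y)) * expR (2 * dl * x) =
      expR (dl * z) * expR (dl * x).
    by rewrite -!expRD; congr expR; rewrite /z; ring.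
  rewrite -(mulrA ep) E1 E2.
  have zE : z <= dl^-1 * expR (dl * z).
    by rewrite ler_pdivlMl // (le_trans _ (expR_ge1Dx _)) // lerDr.
  have E3 : expR (dl * z) <= expR (dl * x).
    by rewrite ler_expR ler_pM2l // /z gerBl.
  have E0 := expR_ge0 (dl * z).
  set q := expR (dl * z) in zE E3 E0 *.
  have h1 : z + q <= C2 * q by rewrite /C2; lra.
  have h2 : ep * (q * q) <= ep * (q * expR (dl * x)).
    by rewrite ler_wpM2l ?ler_wpM2l // ltW.
  have h3 : C2 * q <= ep * (q * q) + K.
    apply: (@le_trans _ _ (ep * (q * q) + C2 ^+ 2 / (4 * ep))); last by rewrite lerD2l.
    have -> : ep * (q * q) + C2 ^+ 2 / (4 * ep) =
        ep * (q - C2 / (2 * ep)) ^+ 2 + C2 * q.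
      by field; lra.
    by rewrite lerDr mulr_ge0 ?sqr_ge0 // ltW.
  rewrite /z in h1 *; lra.
(* On surviving steps the majorant is [Rf (y - x)] plus the nonnegative correction. *)
have under y x : x <= y -> Rf (y - x) <=
    y + K - x - expR (- (dl * y)) * expR (dl * x)
      + ep * expR (- (dl * y)) * expR (2 * dl * x).
  move=> xy; rewrite /Rf.
  have -> : expR (- (dl * (y - x))) = expR (- (dl * y)) * expR (dl * x).
    by rewrite -expRD; congr expR; ring.
  have : 0 <= ep * expR (- (dl * y)) * expR (2 * dl * x).
    by rewrite !mulr_ge0 ?expR_ge0 // ltW.
  lra.
have epE : ep * p2 = c1 by rewrite epE' c1E.
(* Chosen so that the drift of [A * th * Rf] pays exactly for the overshoot term
   [th / dl * E * e^(2 dl x)] in the majorant of [U]. *)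
pose A := p2 / (dl * c1).
have A0 : 0 < A by rewrite divr_gt0 // mulr_gt0.
have AE : A * (dl * c1) = p2 by rewrite /A; field; lra.
clearbody A.
(* With [q = c dl^2], this is [(1 + A) dl], the value of [kap * sqrt N], divided by the lower bound
   [q e^(-q) / (1 + q)] of [N * lam ^+ N * (1 - lam)]. *)
pose Cdec := (1 + A) * dl * (1 + c * dl ^+ 2) * expR (c * dl ^+ 2) / (c * dl ^+ 2).
pose C := Num.max (16 * K ^+ 2 / c1) Cdec.
have hdl : 0 <= dl <= h by clear -hmean hcrit hmoment h0 dl0 dlh; lra.
have h2dl : 0 <= 2 * dl <= h by clear -hmean hcrit hmoment h0 dl0 dlh; lra.
exists Rf, e, C; split.
- by split => //; exact: measurable_funM.
- by split => // y y0; rewrite mulr_ge0 ?expR_ge0 // ltW.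
- move=> y y0.
  have [tB EB] := @tilted_combination (y + K) (-1) 0 (- expR (- (dl * y)))
    (ep * expR (- (dl * y))) dl dl (2 * dl) hdl hdl h2dl.
  apply: (@le_trans _ _ (_ + (e y)%:E)%E).
    apply: leeD2r; apply: (killed_tilt_le mR R0 tB) => x xy.
      apply: le_trans (under y x xy) _; rewrite le_eqVlt; apply/orP; left.
      by apply/eqP; ring.
    apply: le_trans (over y x y0 xy) _; rewrite le_eqVlt; apply/orP; left.
    by apply/eqP; ring.
  rewrite -EFinD lee_fin EB -/p1 -/p2 /Rf /e mul0r addr0.
  have -> : ep * expR (- (dl * y)) * p2 = c1 * expR (- (dl * y)).
    by rewrite -epE; ring.
  by rewrite c1E; clear -hmean hcrit hmoment h0 y0; lra.
- split.
    rewrite le_max; apply/orP; left; apply: divr_ge0; last exact: ltW.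
    by apply: mulr_ge0 => //; exact: sqr_ge0.
  move=> y y0.
  have RK : Rf y <= K * (1 + y).
    rewrite /Rf; have := expR_ge0 (- (dl * y)).
    have : y <= K * y by rewrite ler_peMl.
    lra.
  (* The square of [1 + y <= 4 e^(y / 4)]; half of the decay [e^(-y)] is left over. *)
  have h1 : (1 + y) ^+ 2 <= 16 * expR (y / 2).
    have h4 : 1 + y <= 4 * expR (y / 4).
      have := expR_ge1Dx (y / 4); lra.
    have -> : 16 * expR (y / 2) = (4 * expR (y / 4)) ^+ 2.
      by rewrite exprMn (expr2 (expR _)) -expRD; congr (_ * expR _); [ring|field].
    by rewrite ler_sqr // nnegrE ?mulr_ge0 ?expR_ge0 //; lra.
  have h2 : Rf y ^+ 2 <= K ^+ 2 * (16 * expR (y / 2)).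
    apply: (@le_trans _ _ ((K * (1 + y)) ^+ 2)).
      rewrite ler_sqr // nnegrE ?R0 // mulr_ge0 //; lra.
    by rewrite exprMn ler_wpM2l ?sqr_ge0.
  apply: (@le_trans _ _ (16 * K ^+ 2 / c1 * e y)); last first.
    rewrite ler_wpM2r ?mulr_ge0 ?expR_ge0 //; first exact: ltW.
    by rewrite le_max lexx.
  apply: (@le_trans _ _ (expR (- y) * (K ^+ 2 * (16 * expR (y / 2))))).
    by rewrite ler_wpM2l ?expR_ge0.
  have -> : expR (- y) * (K ^+ 2 * (16 * expR (y / 2))) =
      16 * K ^+ 2 * expR (- (y / 2)).
    have -> : expR (- (y / 2)) = expR (- y) * expR (y / 2).
      by rewrite -expRD; congr expR; lra.
    ring.
  have -> : 16 * K ^+ 2 / c1 * e y = 16 * K ^+ 2 * expR (- (dl * y)).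
    by rewrite /e; field; lra.
  apply: ler_wpM2l; first by apply: mulr_ge0 => //; exact: sqr_ge0.
  rewrite ler_expR lerN2.
  by have := ler_wpM2r y0 dl1; lra.
move=> N N0; clear hp1 p11 ep0 K2 epE'.
set sN := Num.sqrt N%:R.
have sN0 : 0 < sN by rewrite sqrtr_gt0 ltr0n.
have sN1 : 1 <= sN by rewrite -sqrtr1 ler_wsqrtr // ler1n.
have sNN : sN ^+ 2 = N%:R by rewrite sqr_sqrtr.
(* This scale keeps [th^2 N] constant, hence [lam ^+ N] bounded away from 0. *)
pose th := dl / sN.
have th0 : 0 < th by rewrite divr_gt0.
have thdl : th <= dl by rewrite ler_pdivrMr // ler_peMr // ltW.
have thN : th ^+ 2 * N%:R = dl ^+ 2.
  by rewrite -sNN /th; field; lra.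
have thE : th * sN = dl by rewrite /th; field; lra.
clearbody th.
have hth : 0 <= th <= h by clear -hmean hcrit hmoment h0 th0 thdl dlh dl0; lra.
pose mu := c * th ^+ 2.
have mu0 : 0 < mu by rewrite mulr_gt0 // exprn_gt0.
(* Then [lam * laplace th >= 1], which makes the bounded part [1 - e^(-th y)] absorb the source
   [1 - lam]. *)
pose lam := (1 + mu)^-1.
have mu1 : 0 < 1 + mu by lra.
have lam0 : 0 < lam by rewrite invr_gt0.
have lam1 : lam < 1 by rewrite invf_lt1 //; lra.
have lamE : 1 - lam = mu * lam by rewrite /lam; field; lra.
have lapth : 1 + mu <= laplace th.
  by apply: laplace_ge; clear -hmean hcrit hmoment h0 th0 thdl dlh dl1 dl0; lra.
have lamlap : 1 <= lam * laplace th by rewrite /lam ler_pdivlMl ?mulr1; [exact: lapth|exact: mu1].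
pose U y := 1 - expR (- (th * y)) + A * th * Rf y.
have Ath0 : 0 <= A * th by rewrite mulr_ge0 // ltW.
have Uexp y : 0 <= y -> 0 <= 1 - expR (- (th * y)) <= th * y.
  move=> y0; rewrite subr_ge0 expR_le1 oppr_le0 mulr_ge0 ?(ltW th0) //=.
  have := expR_ge1Dx (- (th * y)); lra.
exists U, lam, ((1 + A) * th); split.
- by rewrite lam0 lam1 mulr_ge0 // ltW //; lra.
- apply: measurable_funD; first exact: measurable_funB.
  exact: measurable_funM.
- move=> y y0; have /andP[u0 u1] := Uexp _ y0.
  rewrite addr_ge0 ?mulr_ge0 ?R0 ?(ltW A0) ?(ltW th0) //=.
  rewrite mulrDl mul1r mulrDl lerD // (le_trans u1) // ler_wpM2l ?Ry //.
  exact: ltW.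
- move=> y y0.
  pose E := expR (- (dl * y)).
  have [tB EB] := @tilted_combination (1 + A * th * (y + K)) (- (A * th))
    (- expR (- (th * y))) (- (A * th * E))
    (th / dl * E + A * th * (ep * E)) th dl (2 * dl) hth hdl h2dl.
  have E0 : 0 <= E by exact: expR_ge0.
  have mU : measurable_fun setT U.
    apply: measurable_funD; first exact: measurable_funB.
    exact: measurable_funM.
  have U0 z : 0 <= z -> 0 <= U z.
    move=> z0; have /andP[u0 u1] := Uexp _ z0.
    by rewrite addr_ge0 ?mulr_ge0 ?R0 ?(ltW A0) ?(ltW th0).
  have thdl0 : 0 <= th / dl by rewrite divr_ge0 // ltW.
  have key : (2%:E * \int[P0]_t (expR (xi t) * (xi t <= y)%R%:R * U (y - xi t))%:E
      <= (1 - expR (- (th * y)) * laplace th + A * th * Rf y)%:E)%E.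
    have -> : 1 - expR (- (th * y)) * laplace th + A * th * Rf y =
        1 + A * th * (y + K) + (- expR (- (th * y))) * laplace th
        + (- (A * th * E)) * laplace dl
        + (th / dl * E + A * th * (ep * E)) * laplace (2 * dl).
      rewrite /Rf -/E -/p1 -/p2.
      rewrite (mulrDl _ _ p2).
      have -> : A * th * (ep * E) * p2 = A * th * E * c1 by rewrite -epE; ring.
      have -> : th / dl * E * p2 = A * th * E * c1.
        by rewrite -AE; field; clear -hmean hcrit hmoment h0 dl0; lra.
      by rewrite c1E; field.
    rewrite -EB; apply: (killed_tilt_le mU U0 tB) => x xy.
      have hx := under y x xy; rewrite -/E in hx.
      rewrite /U.
      have -> : expR (- (th * (y - x))) = expR (- (th * y)) * expR (th * x).
        by rewrite -expRD; congr expR; ring.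
      have := ler_wpM2l Ath0 hx.
      have : 0 <= th / dl * E * expR (2 * dl * x).
        by apply: mulr_ge0; [exact: mulr_ge0|exact: expR_ge0].
      by clear -hmean hcrit hmoment h0 A0; lra.
    have hx := over y x y0 xy; rewrite -/E in hx.
    (* The bounded part of [U] is negative past the barrier: [e^(th z) - 1 <= th z e^(th z)], then
       [z <= dl^-1 e^(dl z)] and [th <= dl]. *)
    have h1 : expR (- (th * y)) * expR (th * x) - 1 <=
        th / dl * E * expR (2 * dl * x).
      set z := x - y; have z0 : 0 < z by rewrite subr_gt0.
      rewrite -expRD (_ : - (th * y) + th * x = th * z); last by rewrite /z; ring.
      apply: (@le_trans _ _ (th * z * expR (th * z))).
        have hm := expR_ge1Dx (- (th * z)).
        have := ler_wpM2l (expR_ge0 (th * z)) hm.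
        by rewrite -expRD addrN expR0; clear -hmean hcrit hmoment h0 A0; lra.
      apply: (@le_trans _ _ (th * (dl^-1 * expR (dl * z)) * expR (dl * z))).
        apply: ler_pM; rewrite ?mulr_ge0 ?expR_ge0 ?(ltW th0) ?(ltW z0) //.
          rewrite ler_wpM2l ?(ltW th0) //.
          by rewrite ler_pdivlMl // (le_trans _ (expR_ge1Dx _)) // lerDr.
        by rewrite ler_expR ler_wpM2r // ltW.
      rewrite -!mulrA ler_wpM2l ?(ltW th0) // ler_wpM2l ?invr_ge0 ?(ltW dl0) //.
      rewrite /E -!expRD ler_expR /z.
      have : 0 <= dl * y by rewrite mulr_ge0 // ltW.
      by clear -hmean hcrit hmoment h0 A0; lra.
    by have := mulr_ge0 Ath0 hx; clear -hmean hcrit hmoment h0 h1; lra.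
  have h2 := lee_wpmul2l (ltW lam0 : (0 <= lam%:E)%E) key.
  rewrite muleA -EFinM (mulrC lam) in h2.
  apply: (le_trans (leeD2r _ h2)).
  rewrite -EFinM -EFinD lee_fin /U.
  set eth := expR (- (th * y)); have eth0 : 0 <= eth by exact: expR_ge0.
  have := ler_wpM2l eth0 lamlap.
  have : lam * (A * th * Rf y) <= A * th * Rf y.
    by rewrite ler_piMl ?mulr_ge0 ?R0 ?(ltW A0) ?(ltW th0) ?(ltW lam1).
  by clear -hmean hcrit hmoment h0 A0; lra.
rewrite lamE.
have -> : (1 + A) * th * sN = (1 + A) * dl by rewrite -mulrA thE.
have cd0 : 0 < c * dl ^+ 2 by rewrite mulr_gt0 // exprn_gt0.
have -> : N%:R * lam ^+ N * (mu * lam) = c * dl ^+ 2 * lam ^+ N * lam.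
  by rewrite /mu -thN; ring.
(* From [(1 + mu)^N <= e^(mu N)] and [mu N = c dl^2]. *)
have lamN : expR (- (c * dl ^+ 2)) <= lam ^+ N.
  rewrite /lam exprVn expRN lef_pV2 ?posrE ?expR_gt0 ?exprn_gt0 //.
  have -> : c * dl ^+ 2 = mu * N%:R by rewrite /mu -thN; ring.
  rewrite expRM_natr; apply: lerXn2r; rewrite ?nnegrE ?expR_ge0 ?(ltW mu1) //.
  exact: expR_ge1Dx.
have lamge : (1 + c * dl ^+ 2)^-1 <= lam.
  rewrite /lam lef_pV2 ?posrE //; last lra.
  rewrite lerD2l ler_wpM2l ?(ltW c0) // ler_sqr ?nnegrE ?(ltW th0) ?(ltW dl0) //.
set q := c * dl ^+ 2 in cd0 lamN lamge *.
have Cdec0 : 0 <= Cdec.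
  apply: divr_ge0; last exact: ltW.
  apply: mulr_ge0; last exact: expR_ge0.
  apply: mulr_ge0; last by rewrite -/q; lra.
  by apply: mulr_ge0; clear -hmean hcrit hmoment h0 A0 dl0; lra.
have lamN0 : 0 <= lam ^+ N by rewrite exprn_ge0 // ltW.
have lq : q * expR (- q) * (1 + q)^-1 <= q * lam ^+ N * lam.
  apply: ler_pM => //.
  - by apply: mulr_ge0; [exact: ltW|exact: expR_ge0].
  - by rewrite invr_ge0; lra.
  - by rewrite ler_wpM2l // ltW.
apply: (@le_trans _ _ (Cdec * (q * lam ^+ N * lam))); last first.
  apply: ler_wpM2r; last by rewrite le_max lexx orbT.
  by apply: mulr_ge0; [apply: mulr_ge0 => //|]; exact: ltW.
apply: le_trans (ler_wpM2l Cdec0 lq).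
rewrite le_eqVlt; apply/orP; left; apply/eqP.
rewrite /Cdec -/q expRN; field.
by rewrite !gt_eqF ?expR_gt0 //=; clear -hmean hcrit hmoment h0 cd0; lra.
Qed.

End tilted_walk.

(** * Tents *)

Definition dyadic_index (s : seq bool) : nat :=
  foldl (fun n (b : bool) => n.*2 + b)%N 0%N s.

Lemma dyadic_index_rcons s b :
  dyadic_index (rcons s b) = ((dyadic_index s).*2 + b)%N.
Proof. by rewrite /dyadic_index foldl_rcons. Qed.

Lemma dyadic_index_inj s t :
  size s = size t -> dyadic_index s = dyadic_index t -> s = t.
Proof.
elim/last_ind: s t => [|s b ih] t; first by case: t.
case/lastP: t => [|t c]; rewrite !size_rcons // => -[st].
rewrite !dyadic_index_rcons => e.
have bc : b = c.
  by have := congr1 odd e; rewrite !oddD !odd_double !oddb.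
congr rcons => //; apply: ih => //; move: e; rewrite bc => /addIn.
exact: double_inj.
Qed.

(** The point [i 2^(-n)], with [n = size s], is the left or the right end of the interval of [s]. *)
Definition index_adjacent (i : nat) (s : seq bool) : bool :=
  (i == dyadic_index s) || (i == (dyadic_index s).+1).

(** Two intervals at most meet a dyadic point, and they are told apart by whether it is their left
    end. *)
Lemma card_adjacent k i : (#|[pred s : k.-tuple bool | index_adjacent i s]| <= 2)%N.
Proof.
rewrite -card_bool.
apply: (@leq_card_in _ _ (fun s : k.-tuple bool => i == dyadic_index s)).
move=> s t; rewrite !inE /index_adjacent => hs ht /eqP e.
apply: val_inj; apply: dyadic_index_inj; first by rewrite !size_tuple.
move: e hs ht; case: (i =P _) => h1; case: (i =P _) => h2 //= _.
  by rewrite -h1 -h2.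
by move=> /eqP e1 /eqP e2; apply: succn_inj; rewrite -e1 -e2.
Qed.

Lemma card_adjacent_index n s :
  (#|[pred i : 'I_n | index_adjacent i s]| <= 2)%N.
Proof.
rewrite -card_bool.
apply: (@leq_card_in _ _ (fun i : 'I_n => val i == dyadic_index s)).
move=> i j; rewrite !inE /index_adjacent => hi hj /eqP e; apply: val_inj => /=.
move: e hi hj.
case: (_ =P _) => h1; case: (_ =P _) => h2 //= _.
  by rewrite h1 h2.
by move=> /eqP -> /eqP ->.
Qed.

Section tents.
Context (R : realType).
Implicit Types (s : seq bool) (x : R).

Lemma dyadic_left_rcons s b :
  dyadic_left R (rcons s b) = dyadic_left R s + b%:R / 2 ^+ (size s).+1.
Proof.
rewrite /dyadic_left; move: (size_rcons s b) => e.
rewrite -(big_mkord xpredT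
  (fun k => (nth false (rcons s b) k)%:R / 2 ^+ k.+1)) e.
rewrite big_nat_recr //= big_mkord nth_rcons ltnn eqxx; congr (_ + _).
by apply: eq_bigr => k _; rewrite nth_rcons ltn_ord.
Qed.

Lemma dyadic_leftE s : dyadic_left R s = (dyadic_index s)%:R / 2 ^+ size s.
Proof.
elim/last_ind: s => [|s b ih]; first by rewrite /dyadic_left big_ord0 mul0r.
rewrite dyadic_left_rcons ih dyadic_index_rcons size_rcons natrD -muln2 natrM.
by rewrite exprS; field; rewrite expf_eq0 pnatr_eq0 andbF.
Qed.

(* MathComp-Analysis has another [dyadic_itv], hence the qualified name. *)
Lemma dyadic_itv_rcons s b :
  @Defs.dyadic_itv R (rcons s b) `<=` @Defs.dyadic_itv R s.
Proof.
move=> x; rewrite /Defs.dyadic_itv /= !in_itv /= dyadic_left_rcons size_rcons.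
have q0 : 0 < (2 : R) ^- (size s).+1 by rewrite invr_gt0 exprn_gt0.
have -> : (2 : R) ^- size s = 2 * 2 ^- (size s).+1.
  by rewrite exprS; field; rewrite expf_eq0 pnatr_eq0 andbF.
case: b => /=; rewrite ?mul1r ?mul0r => /andP[h1 h2]; apply/andP; split; lra.
Qed.

Lemma dyadic_itv_take s k : (k <= size s)%N ->
  @Defs.dyadic_itv R s `<=` @Defs.dyadic_itv R (take k s).
Proof.
elim/last_ind: s => [|s b ih]; first by case: k => [|k] _ y.
rewrite size_rcons leq_eqVlt => /orP[/eqP ->|].
  by move=> y; rewrite take_oversize ?size_rcons.
rewrite ltnS => ks; rewrite -cats1 takel_cat // cats1.
exact: subset_trans (@dyadic_itv_rcons s b) (ih ks).
Qed.

Lemma lebesgue_dyadic_itv s :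
  lebesgue_measure (@Defs.dyadic_itv R s) = ((2 : R) ^- size s)%:E.
Proof.
rewrite /Defs.dyadic_itv lebesgue_measure_itv /= lte_fin ltrDl invr_gt0.
by rewrite exprn_gt0 // -EFinD addrAC subrr add0r.
Qed.

(** A hat of height 1 centred at [i 2^(-k)], of half-width [2^(-k)]: a continuous replacement for
    interval indicators, admissible in weak convergence. *)
Definition tent (k i : nat) (x : R) : R :=
  Num.max 0 (1 - `|2 ^+ k * x - i%:R|).

Lemma tent_ge0 k i x : 0 <= tent k i x.
Proof. by rewrite le_max lexx. Qed.

Lemma tent_le1 k i x : tent k i x <= 1.
Proof. by rewrite ge_max ler01 gerBl normr_ge0. Qed.

Lemma continuous_tent k i : continuous (tent k i).
Proof.
move=> x; apply: (@continuous_max R R (cst 0) _ x); first exact: cvg_cst.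
apply: cvgB; first exact: cvg_cst.
apply: cvg_norm; apply: cvgB; last exact: cvg_cst.
by apply: cvgM; [exact: cvg_cst|exact: cvg_id].
Qed.

Lemma measurable_tent k i : measurable_fun [set: R] (tent k i).
Proof. by apply: continuous_measurable_fun => x; exact: continuous_tent. Qed.

(** On the interval of index [j], [2^n x] lies between [j] and [j + 1], so [|2^n x - i| < 1] leaves
    only [i = j] and [i = j + 1]. *)
Lemma tent_adjacent i s x : @Defs.dyadic_itv R s x ->
  0 < tent (size s) i x -> index_adjacent i s.
Proof.
rewrite /Defs.dyadic_itv /= in_itv /= dyadic_leftE.
set n := size s; have p0 : 0 < (2 : R) ^+ n by rewrite exprn_gt0.
rewrite -[X in _ < _ + X]mul1r -mulrDl => /andP[].
rewrite ler_pdivrMr // ltr_pdivlMr // => h1 h2.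
rewrite lt_max ltxx subr_gt0 ltr_norml (mulrC (_ ^+ _)) => /andP[h3 h4].
have h5 : (dyadic_index s)%:R < (i.+1)%:R :> R by rewrite -natr1; lra.
have h6 : i%:R < ((dyadic_index s).+2)%:R :> R by rewrite -!natr1; lra.
move: h5 h6; rewrite !ltr_nat /index_adjacent !ltnS => h5.
rewrite leq_eqVlt => /orP[->|]; first by rewrite orbT.
by rewrite ltnS => h6; rewrite eqn_leq h5 h6.
Qed.

(** Take the nearest dyadic point. Near 1 it is [2 ^ k] itself, hence [(2 ^ k).+1] tents. *)
Lemma tent_ge_half k x : 0 <= x <= 1 ->
  exists i : 'I_(2 ^ k).+1, 2^-1 <= tent k i x.
Proof.
move=> /andP[x0 x1].
have p0 : 0 < (2 : R) ^+ k by rewrite exprn_gt0.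
have y0 : 0 <= 2 ^+ k * x by rewrite mulr_ge0 // ltW.
have y1 : 2 ^+ k * x <= 2 ^+ k by rewrite ler_piMr // ltW.
have := truncn_itv y0; set n := Num.Def.trunc _ => /andP[h1 h2].
have n2k : (n <= 2 ^ k)%N.
  by rewrite -(ler_nat R) natrX; exact: le_trans y1.
have [h|h] := leP (2 ^+ k * x - n%:R) 2^-1.
  exists (Ordinal (n2k : (n < (2 ^ k).+1)%N)); rewrite /tent /=.
  have -> : `|2 ^+ k * x - n%:R| = 2 ^+ k * x - n%:R by rewrite ger0_norm ?subr_ge0.
  by rewrite le_max; apply/orP; right; lra.
have n2k' : (n < 2 ^ k)%N.
  rewrite -(ltr_nat R) natrX; apply: lt_le_trans y1; lra.
exists (Ordinal (n2k' : (n.+1 < (2 ^ k).+1)%N)); rewrite /tent /=.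
have -> : `|2 ^+ k * x - n.+1%:R| = n.+1%:R - 2 ^+ k * x.
  by rewrite ler0_norm ?opprB // subr_le0 ltW.
by rewrite le_max -(natr1 n); apply/orP; right; lra.
Qed.

End tents.

(** * The approximating measures tested against tents *)

Section approximations.
Context (R : realType) d (T : measurableType d) (x : seq bool -> T -> R).

Lemma critical_approxE n w U : measurable U -> critical_approx x n w U =
  (\sum_(s : n.-tuple bool)
     (Num.sqrt n%:R * expR (branch_sum x s w) / 2 ^- n)%:E *
       lebesgue_measure (U `&` @Defs.dyadic_itv R s))%E.
Proof.
move=> mU; rewrite /critical_approx /critical_density.
under eq_integral do rewrite -sumEFin.
have mI s : measurable (@Defs.dyadic_itv R s) by exact: measurable_itv.
rewrite ge0_integral_sum //.
- apply: eq_bigr => s _; under eq_integral do rewrite EFinM.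
  rewrite ge0_integralZl_EFin //.
  + congr mule; rewrite setIC.
    exact: (@integral_indic _ _ _ lebesgue_measure U mU _ (mI s)).
  + by apply/measurable_EFinP; apply: measurable_indic; exact: mI.
- move=> s; apply/measurable_EFinP; apply: measurable_funM => //.
  by apply: measurable_indic; exact: mI.
Qed.

Definition tent_approx k i n w : \bar R :=
  (\int[critical_approx x n w]_(y in `[0%R, 1%R]) (tent k i y)%:E)%E.

Lemma tent_approx_ge0 k i n w : (0 <= tent_approx k i n w)%E.
Proof. by apply: integral_ge0 => y _; rewrite lee_fin tent_ge0. Qed.

(** The tent is at most 1 and vanishes on every interval of generation [k] not adjacent to its
    centre. *)
Lemma tent_approx_le k i n w : (k <= n)%N ->
  (tent_approx k i n w <= (\sum_(s : n.-tuple bool | index_adjacent i (take k s))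
     Num.sqrt n%:R * expR (branch_sum x s w))%:E)%E.
Proof.
move=> kn; pose S := (tent k i : R -> R) @^-1` `]0, +oo[.
have mS : measurable S.
  rewrite -[X in measurable X]setTI.
  exact: (@measurable_tent R k i measurableT _ (measurable_itv _)).
have m01 : measurable (`[0, 1] : set R) by exact: measurable_itv.
apply: (@le_trans _ _ (critical_approx x n w (S `&` `[0, 1]))).
  rewrite -integral_indic //; apply: ge0_le_integral => //.
  - by move=> y _; rewrite lee_fin tent_ge0.
  - by apply/measurable_EFinP; apply: measurable_funTS; exact: measurable_tent.
  - by apply/measurable_EFinP; apply: measurable_funTS; exact: measurable_indic.
  move=> y _; rewrite lee_fin indicE.
  case: (boolP (y \in S)) => [_|]; first exact: tent_le1.
  by rewrite notin_setE /S /= in_itv /= andbT => /negP; rewrite -leNgt.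
rewrite critical_approxE; last exact: measurableI.
rewrite -sumEFin [leRHS]big_mkcond /=; apply: lee_sum => s _.
have mI : measurable (@Defs.dyadic_itv R s) by exact: measurable_itv.
have c0 : 0 <= Num.sqrt n%:R * expR (branch_sum x s w).
  by rewrite mulr_ge0 ?sqrtr_ge0 ?expR_ge0.
have p0 : 0 < (2 : R) ^- n by rewrite invr_gt0 exprn_gt0.
case: ifPn => [_|].
  apply: (@le_trans _ _ ((Num.sqrt n%:R * expR (branch_sum x s w) / 2 ^- n)%:E *
      lebesgue_measure (@Defs.dyadic_itv R s))%E).
    apply: lee_wpmul2l; first by rewrite lee_fin divr_ge0 // ltW.
    by apply: le_measure; rewrite ?inE //; apply: measurableI => //;
      exact: measurableI.
  by rewrite lebesgue_dyadic_itv size_tuple -EFinM divfK // gt_eqF.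
move=> nadj; rewrite (_ : _ `&` _ = set0) ?measure0 ?mule0 //.
apply/seteqP; split=> // y [[Sy _] sy]; move/negP: nadj; apply.
apply: (@tent_adjacent R i (take k s) y).
  by apply: dyadic_itv_take sy; rewrite size_tuple.
by move: Sy; rewrite /S /= in_itv /= andbT size_takel // size_tuple.
Qed.

End approximations.

(** The space is arbitrary so that both [mu1] on [T] and the approximations on the coarser
    [words_off] are covered. *)
Lemma measurable_integral_tent d (T : measurableType d) (R : realType)
    (l : T -> {measure set R -> \bar R}) k i :
  (forall U, measurable U -> measurable_fun [set: T] (l ^~ U)) ->
  measurable_fun [set: T] (fun w => (\int[l w]_(y in `[0%R, 1%R]) (tent k i y)%:E)%E).
Proof.
move=> ml; under eq_fun do rewrite integral_mkcond.
apply: (@measurable_fun_integral_kernel _ _ _ _ _ l ml).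
  by move=> y; rewrite patchE; case: ifP => // _; rewrite lee_fin tent_ge0.
apply/(measurable_restrictT _ (measurable_itv _)).
by apply/measurable_EFinP; apply: measurable_funTS; exact: measurable_tent.
Qed.

Section approximations_known.
Context (R : realType) d (T : measurableType d) (P : probability T R)
  (xis : seq bool -> {RV P >-> R}).

Lemma known_tent_approx k i n t : (n < size t)%N ->
  measurable_fun [set: words_off xis t] (tent_approx xis k i n).
Proof.
move=> nt.
apply: (@measurable_integral_tent _ (words_off xis t) R
  (fun w => critical_approx xis n w)) => U mU.
have -> : (fun w : words_off xis t => critical_approx xis n w U) =
  (fun w => \sum_(s : n.-tuple bool)
     (Num.sqrt n%:R * expR (branch_sum xis s w) / 2 ^- n)%:E *
       lebesgue_measure (U `&` @Defs.dyadic_itv R s))%E.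
  by apply/funext => w; exact: critical_approxE.
apply: emeasurable_sum => s.
apply: emeasurable_funM => //; apply/measurable_EFinP.
do 2 apply: measurable_funM => //.
apply: measurableT_comp => //; apply: measurable_branch_sum_off.
  by rewrite size_tuple ltnW.
by apply: contraTneq nt => <-; rewrite size_tuple ltnn.
Qed.

End approximations_known.

(** * Atoms *)

Lemma cvg0_near_le (R : realType) (u : nat -> \bar R) : u @ \oo --> 0%E ->
  forall eta : R, 0 < eta -> exists N, forall n, (N <= n)%N -> (u n <= eta%:E)%E.
Proof.
move=> /fine_cvgP[[N1 _ h1] /cvgrPdist_le h] eta eta0.
have [N2 _ h2] := h _ eta0; exists (maxn N1 N2) => n.
rewrite geq_max => /andP[n1 n2]; have := h2 n n2; rewrite /= sub0r normrN => h3.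
by rewrite -(fineK (h1 n n1)) lee_fin; apply: le_trans h3; exact: ler_norm.
Qed.

Lemma measurable_superlevel (R : realType) d (T : measurableType d)
    (f : T -> R) (c : R) :
  measurable_fun [set: T] f -> measurable [set w | c <= f w].
Proof.
move=> mf; rewrite (_ : [set w | _] = f @^-1` `[c, +oo[); last first.
  by apply/seteqP; split=> w /=; rewrite in_itv /= andbT.
by rewrite -[X in measurable X]setTI; apply: mf => //; exact: measurable_itv.
Qed.

Section atoms.
Context (R : realType) d0 (T0 : measurableType d0) (P0 : probability T0 R)
  (xi : {RV P0 >-> R}) d (T : measurableType d) (P : probability T R)
  (xis : seq bool -> {RV P >-> R})
  (hlaw : forall s : seq bool, s != [::] -> identically_distributed (xis s) xi)
  (hindep : mutually_independent [set s : seq bool | s != [::]] xis).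
Context (hmass : ((2%:E * \int[P0]_t (expR (xi t))%:E <= 1)%E)).
Context (Rf e : R -> R) (C : R) (mR : measurable_fun setT Rf)
  (me : measurable_fun setT e) (R0 : forall y, 0 <= y -> 0 <= Rf y)
  (e0 : forall y, 0 <= y -> 0 <= e y)
  (hR : forall y, 0 <= y -> (2%:E *
     \int[P0]_t (expR (xi t) * (xi t <= y)%R%:R * Rf (y - xi t))%:E +
     (e y)%:E <= (Rf y)%:E)%E)
  (C0 : 0 <= C) (hC : forall y, 0 <= y -> expR (- y) * Rf y ^+ 2 <= C * e y)
  (hU : forall N, (0 < N)%N -> exists (U : R -> R) (lam kap : R),
        [/\ 0 < lam < 1 /\ 0 <= kap, measurable_fun setT U,
            forall y, 0 <= y -> 0 <= U y <= kap * Rf y,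
            (forall y, 0 <= y -> ((2 * lam)%:E *
              \int[P0]_t (expR (xi t) * (xi t <= y)%R%:R * U (y - xi t))%:E +
              (1 - lam)%:E <= (U y)%:E)%E) &
            kap * Num.sqrt N%:R <= C * (N%:R * lam ^+ N * (1 - lam))]).
Context (a : R) (a0 : 0 <= a).
Local Notation X := (branch_sum xis).
Local Notation g := (killed_weight xis a).
Local Notation A := (killed_functional xis a).
Local Notation E := (below_barrier xis a).
Local Notation F := (below_forever xis a).

Lemma tent_approx_fin k i n w : (k <= n)%N ->
  tent_approx xis k i n w \is a fin_num.
Proof.
move=> kn; rewrite ge0_fin_numE ?tent_approx_ge0 //.
exact: le_lt_trans (tent_approx_le _ _ _ kn) (ltry _).
Qed.

Definition tent_real k i n (w : T) : R := fine (tent_approx xis k i n w).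

Lemma known_tent_real k i n : known_at xis n (tent_real k i n).
Proof.
move=> t nt; apply: measurableT_comp => //; exact: known_tent_approx.
Qed.

Lemma measurable_tent_real k i n : measurable_fun [set: T] (tent_real k i n).
Proof. exact: known_at_measurable (@known_tent_real k i n). Qed.

(** The horizon in [hU] is [N = m]; passing from [sqrt m] to [sqrt (2 m)] costs at most a factor
    2. *)
Lemma level_barrier_decay k m D H : (k <= m)%N -> (0 < m)%N ->
  known_at xis m H -> (forall w, 0 <= H w) ->
  ((Num.sqrt (m + m)%:R)%:E * level xis a k (m + m) D H (fun=> 1%R) <=
   (2 * C)%:E * level xis a k m D H Rf)%E.
Proof.
move=> km m0 kH H0.
have [U [lam [kap [[/andP[l0 l1] kap0] mU UR hUs hk]]]] := hU m0.
have := level1_decay hlaw hindep a0 hmass D km kH H0 l0 l1 mU mR m0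
  (fun y y0 => proj1 (andP (UR y y0))) (fun y y0 => proj2 (andP (UR y y0)))
  kap0 R0 hUs hk.
move=> h; have l10 : (0 <= level xis a k (m + m) D H (fun=> 1%R))%E.
  exact: level_ge0.
apply: (@le_trans _ _ ((2 * Num.sqrt m%:R)%:E *
    level xis a k (m + m) D H (fun=> 1%R))%E).
  apply: lee_wpmul2r => //; rewrite lee_fin.
  rewrite -[leRHS]ger0_norm ?mulr_ge0 ?sqrtr_ge0 // -sqrtr_sqr ler_wsqrtr //.
  by rewrite exprMn sqr_sqrtr // natrD; have := ler0n R m; lra.
rewrite EFinM -muleA (EFinM 2 C) -[leRHS]muleA.
by apply: lee_wpmul2l; rewrite ?lee_fin.
Qed.

(** Markov's inequality at time [2 m]: on [F] nothing has been killed, so the tent mass, at least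
    [ep] on [V'], is bounded by the killed sum. *)
Lemma crossing_mass k i m (ep : R) (V V' : set T) :
  0 < ep -> (k <= m)%N -> (0 < m)%N ->
  V = [set w | 2 * ep <= tent_real k i m w] ->
  V' = [set w | ep <= tent_real k i (m + m) w] ->
  (ep%:E * P (V `&` V' `&` F) <= (2 * C)%:E *
     level xis a k m (index_adjacent i) (\1_(V `&` E m)) Rf)%E.
Proof.
move=> ep0 km m0 VE V'E.
(* [F] depends on the whole future; the larger event [E m] is known at time [m]. *)
set H := \1_(V `&` E m) : T -> R.
have mV : measurable V by rewrite VE; apply: measurable_superlevel; exact: measurable_tent_real.
have mV' : measurable V' by rewrite V'E; apply: measurable_superlevel; exact: measurable_tent_real.
have mF := measurable_below_forever xis a0.
have kH : known_at xis m H.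
  move=> t mt; apply: measurable_indic; apply: measurableI; last first.
    exact: measurable_below_barrier_off.
  rewrite VE; apply: (@measurable_superlevel _ _ (words_off xis t)).
  exact: known_tent_real.
have H0 w : 0 <= H w by [].
apply: le_trans (level_barrier_decay (index_adjacent i) km m0 kH H0).
have mH := known_at_measurable kH.
have sq0 : 0 <= Num.sqrt (m + m)%:R :> R by exact: sqrtr_ge0.
have mterm s : measurable_fun [set: T] (fun w => (H w * A (fun=> 1) s w)%:E).
  apply/measurable_EFinP; apply: measurable_funM => //.
  exact: measurable_killed_functional.
have term0 s w : (0 <= (H w * A (fun=> 1) s w)%:E)%E.
  by rewrite lee_fin mulr_ge0 // killed_functional_ge0.
have mS : measurable (V `&` V' `&` F).
  by apply: measurableI => //; exact: measurableI.
rewrite /level ge0_sume_distrr; last by move=> s _; exact: integral_ge0.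
rewrite -[X in P X]setIT -integral_indic // -ge0_integralZl_EFin //; last 2 first.
- by apply/measurable_EFinP; exact: measurable_indic.
- exact: ltW.
have -> : (\sum_(s : (m + m).-tuple bool | index_adjacent i (take k s))
    (Num.sqrt (m + m)%:R)%:E * \int[P]_w (H w * A (fun=> 1%R) s w)%:E =
  \int[P]_w \sum_(s <- [seq val s | s <- enum [pred s : (m + m).-tuple bool | index_adjacent i (take k s)]])
    ((Num.sqrt (m + m)%:R)%:E * (H w * A (fun=> 1%R) s w)%:E))%E.
  rewrite ge0_integral_sum //; last 2 first.
  - by move=> s; apply: measurable_funeM.
  - by move=> s w _; rewrite mule_ge0.
  rewrite big_map big_enum /=; apply: eq_bigr => s _.
  by rewrite ge0_integralZl_EFin.
apply: ge0_le_integral => //.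
- by move=> w _; rewrite -EFinM lee_fin mulr_ge0 // ltW.
- by apply: measurable_funeM; apply/measurable_EFinP; exact: measurable_indic.
- by apply: emeasurable_sum => s; exact: measurable_funeM.
move=> w _; have sum0 : (0 <= \sum_(s <- [seq val s | s <- enum [pred s : (m + m).-tuple bool | index_adjacent i (take k s)]])
    ((Num.sqrt (m + m)%:R)%:E * (H w * A (fun=> 1%R) s w)%:E))%E.
  by apply: sume_ge0 => s _; rewrite mule_ge0.
rewrite [in leLHS]indicE; case: (boolP (w \in _)); last by rewrite mule0.
rewrite inE => -[[Vw V'w] Fw]; rewrite mule1.
have {}V'w : ep <= tent_real k i (m + m) w by rewrite V'E in V'w.
have Ew n : E n w by exact: Fw.
have Hw : H w = 1 by rewrite /H indicE mem_set.
have kmm : (k <= m + m)%N by rewrite (leq_trans km) ?leq_addr.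
apply: (@le_trans _ _ (tent_approx xis k i (m + m) w)).
  by rewrite -(fineK (tent_approx_fin i w kmm)) lee_fin.
apply: (le_trans (tent_approx_le _ _ _ kmm)).
rewrite -sumEFin big_map big_enum /= Hw; apply: lee_sum => s _.
by rewrite mul1r /killed_functional mulr1 (@killed_weightE _ _ _ _ _ _ _ (m + m))
  ?size_tuple.
Qed.

(** Young's inequality [2 C B <= ep / 2 + (2 C^2 / ep) B^2] on [V], where [B] is the sum of the
    [A Rf s]. *)
Lemma level_square k i m (ep : R) (V : set T) : 0 < ep -> (k <= m)%N ->
  measurable V ->
  ((2 * C)%:E * level xis a k m (index_adjacent i) (\1_V) Rf <=
   (ep / 2)%:E * P V + (2 * C ^+ 2 / ep)%:E *
     pair_sum xis a Rf k m (index_adjacent i))%E.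
Proof.
move=> ep0 km mV.
pose r := [seq val s | s <- enum [pred s : m.-tuple bool | index_adjacent i (take k s)]].
pose B w := \sum_(s <- r) A Rf s w.
have A0 s w : 0 <= A Rf s w by exact: killed_functional_ge0.
have B0 w : 0 <= B w by exact: sumr_ge0.
have mA s : measurable_fun [set: T] (A Rf s) by exact: measurable_killed_functional.
have mB : measurable_fun [set: T] B by exact: measurable_sum.
have mV1 : measurable_fun [set: T] (\1_V : T -> R) by exact: measurable_indic.
have -> : level xis a k m (index_adjacent i) (\1_V) Rf = (\int[P]_w (\1_V w * B w)%:E)%E.
  under eq_integral do rewrite /B mulr_sumr -sumEFin.
  rewrite ge0_integral_sum //.
  - by rewrite /r big_map big_enum.
  - by move=> s; apply/measurable_EFinP; exact: measurable_funM.
  - by move=> s w _; rewrite lee_fin mulr_ge0.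
have -> : pair_sum xis a Rf k m (index_adjacent i) = (\int[P]_w (B w * B w)%:E)%E.
  have BB w : (B w * B w)%:E =
      (\sum_(s <- r) \sum_(t <- r) (A Rf s w * A Rf t w)%:E)%E.
    rewrite /B big_distrl /= -sumEFin; apply: eq_bigr => s _.
    by rewrite big_distrr /= -sumEFin.
  under eq_integral do rewrite BB.
  rewrite ge0_integral_sum //.
  - rewrite /r big_map big_enum /=; apply: eq_bigr => s _.
    rewrite ge0_integral_sum //.
    + by rewrite big_map big_enum.
    + by move=> t; apply/measurable_EFinP; exact: measurable_funM.
    + by move=> t w _; rewrite lee_fin mulr_ge0.
  - move=> s; apply: emeasurable_sum => t; apply/measurable_EFinP.
    exact: measurable_funM.
  - by move=> s w _; apply: sume_ge0 => t _; rewrite lee_fin mulr_ge0.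
have c0 : 0 <= 2 * C ^+ 2 / ep by rewrite divr_ge0 ?mulr_ge0 ?sqr_ge0 // ltW.
have c1 : 0 <= 2 * C by rewrite mulr_ge0.
have c2 : 0 <= ep / 2 by rewrite divr_ge0 // ltW.
have VB0 w : 0 <= \1_V w * B w :> R by rewrite mulr_ge0.
have BB0 w : 0 <= B w * B w by rewrite mulr_ge0.
have mVB : measurable_fun [set: T] (fun w => (\1_V w * B w)%:E).
  by apply/measurable_EFinP; exact: measurable_funM.
have mBB : measurable_fun [set: T] (fun w => (B w * B w)%:E).
  by apply/measurable_EFinP; exact: measurable_funM.
have mVE : measurable_fun [set: T] (fun w => (\1_V w : R)%:E) by apply/measurable_EFinP.
rewrite -[X in P X]setIT -integral_indic //.
rewrite -!ge0_integralZl_EFin //; try by move=> w _; rewrite lee_fin.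
rewrite -ge0_integralD //; last 4 first.
- by move=> w _; rewrite -EFinM lee_fin mulr_ge0.
- exact: measurable_funeM.
- by move=> w _; rewrite -EFinM lee_fin mulr_ge0.
- exact: measurable_funeM.
apply: ge0_le_integral => //.
- by move=> w _; rewrite -EFinM lee_fin mulr_ge0.
- exact: measurable_funeM.
- by apply: emeasurable_funD; exact: measurable_funeM.
move=> w _; rewrite -!EFinM -EFinD lee_fin indicE.
case: (w \in V) => /=; last by rewrite mul0r !mulr0 add0r mulr_ge0.
rewrite mul1r mulr1.
have -> : ep / 2 + 2 * C ^+ 2 / ep * (B w * B w) =
    2 * C * B w + ep / 2 * (1 - 2 * C / ep * B w) ^+ 2.
  by field; lra.
by rewrite lerDl mulr_ge0 ?sqr_ge0.
Qed.

(* The times [m] and [2 m] are compared: what has mass at time [m] on the event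
   that nothing crosses keeps it at time [2 m], while the conditional expectation
   is a multiple of [B_m]. *)
Lemma tent_tail k i (Y : T -> R) (S ep : R) : 0 < ep -> 0 <= S ->
  measurable_fun [set: T] Y ->
  cvg_in_probability P (tent_real k i) Y ->
  (forall m, (\sum_(k <= j < m) square_sum xis a Rf k j (index_adjacent i) <= S%:E)%E) ->
  (P ([set w | (3 * ep <= Y w)%R] `&` F) <= (8 * C ^+ 2 / ep ^+ 2 * S)%:E)%E.
Proof.
move=> ep0 S0 mY cY hS.
apply/lee_addgt0Pr => eta eta0.
have mD n : measurable_fun [set: T] (fun w => `|tent_real k i n w - Y w|).
  apply: measurableT_comp => //; apply: measurable_funB => //.
  exact: measurable_tent_real.
have ep20 : 0 < ep / 2 by rewrite divr_gt0.
have eta8 : 0 < eta / 8 by rewrite divr_gt0.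
have [N1 h1] := cvg0_near_le (cY _ ep20) eta8.
have [N2 h2] := cvg0_near_le (below_barrier_cvg xis a0) eta8.
pose m := (maxn (maxn N1 N2) k).+1.
have [mN1 mN2 km] : [/\ (N1 <= m)%N, (N2 <= m)%N & (k <= m)%N].
  by split; apply: leqW; rewrite !leq_max leqnn ?orbT.
have m0 : (0 < m)%N by [].
have mF := measurable_below_forever xis a0.
pose V := [set w | 2 * ep <= tent_real k i m w].
pose V' := [set w | ep <= tent_real k i (m + m) w].
pose d1 := [set w | ep / 2 <= `|tent_real k i m w - Y w|].
pose d2 := [set w | ep / 2 <= `|tent_real k i (m + m) w - Y w|].
pose W := [set w | 3 * ep <= Y w].
have mV : measurable V by apply: measurable_superlevel; exact: measurable_tent_real.
have mV' : measurable V' by apply: measurable_superlevel; exact: measurable_tent_real.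
have md1 : measurable d1 by exact: measurable_superlevel.
have md2 : measurable d2 by exact: measurable_superlevel.
have mW : measurable W by exact: measurable_superlevel.
have mE := measurable_below_barrier xis a0 m.
have real B : measurable B -> exists p : R, P B = p%:E.
  by move=> mB; exists (fine (P B)); rewrite fineK ?fin_num_measure.
have P1 : (P d1 <= (eta / 8)%:E)%E by exact: h1.
have P2 : (P d2 <= (eta / 8)%:E)%E by apply: h1; rewrite (leq_trans mN1) ?leq_addr.
have P3 : (P (E m `\` F) <= (eta / 8)%:E)%E by exact: h2.
(* Off [d1] the mass at time [m] exceeds [3 ep - ep / 2], hence [2 ep]. *)
have I1 : (P (W `&` F) <= P (V `&` F) + P d1)%E.
  have mVF : measurable (V `&` F) by exact: measurableI.
  apply: le_trans (measureU2 _ mVF md1).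
  apply: le_measure; rewrite ?inE; [exact: measurableI|exact: measurableU|].
  move=> w [Ww Fw]; have [h|h] := leP (2 * ep) (tent_real k i m w).
    by left.
  right; rewrite /d1 /=; rewrite /W /= in Ww.
  rewrite distrC; apply: le_trans (ler_norm _); lra.
have I2 : (P (V `&` F) <= P (V `&` V' `&` F) + (P d1 + P d2))%E.
  have mVVF : measurable (V `&` V' `&` F).
    by apply: measurableI => //; exact: measurableI.
  have md : measurable (d1 `|` d2) by exact: measurableU.
  apply: (@le_trans _ _ (P (V `&` V' `&` F) + P (d1 `|` d2))%E); last first.
    by apply: leeD2l; exact: measureU2.
  apply: le_trans (measureU2 _ mVVF md).
  apply: le_measure; rewrite ?inE; [exact: measurableI|exact: measurableU|].
  move=> w [Vw Fw]; have [h|h] := leP ep (tent_real k i (m + m) w).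
    by left.
  right; rewrite /V /= in Vw.
  have [h3|h3] := leP (ep / 2) `|tent_real k i m w - Y w|; first by left.
  right; rewrite /d2 /= distrC; apply: le_trans (ler_norm _).
  have := ler_norm (tent_real k i m w - Y w); lra.
have mVE : measurable (V `&` E m) by exact: measurableI.
have I3 : (P (V `&` E m) <= P (V `&` F) + P (E m `\` F))%E.
  have mVF : measurable (V `&` F) by exact: measurableI.
  have mEF : measurable (E m `\` F) by exact: measurableD.
  apply: le_trans (measureU2 _ mVF mEF).
  apply: le_measure; rewrite ?inE //; first exact: measurableU.
  by move=> w [Vw Ew]; have [h|h] := pselect (F w); [left|right].
have I4 := @crossing_mass k i m ep V V' ep0 km m0 erefl erefl.
have I5 := level_square i ep0 km mVE.
have I6 : (pair_sum xis a Rf k m (index_adjacent i) <= 2%:E * S%:E)%E.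
  apply: le_trans (pair_sum_le hlaw hindep a0 mR me R0 e0 hR (card_adjacent k i) km) _.
  by apply: lee_wpmul2l => //; exact: hS.
have c0 : 0 <= 2 * C ^+ 2 / ep by rewrite divr_ge0 ?mulr_ge0 ?sqr_ge0 // ltW.
have I7 := le_trans (le_trans I4 I5) (leeD2l _ (lee_wpmul2l (c0 : (0 <= (_)%:E)%E) I6)).
have mVVF : measurable (V `&` V' `&` F).
  by apply: measurableI => //; exact: measurableI.
have [p pE] := real _ (measurableI _ _ mW mF).
have [q qE] := real _ (measurableI _ _ mV mF).
have [q' q'E] := real _ mVVF.
have [z zE] := real _ mVE.
have [r rE] := real _ (measurableD mE mF).
have [x1 x1E] := real _ md1.
have [x2 x2E] := real _ md2.
rewrite pE qE x1E -EFinD lee_fin in I1.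
rewrite qE q'E x1E x2E -!EFinD lee_fin in I2.
rewrite zE qE rE -EFinD lee_fin in I3.
rewrite q'E zE -!EFinM -EFinD lee_fin in I7.
rewrite x1E lee_fin in P1; rewrite x2E lee_fin in P2; rewrite rE lee_fin in P3.
rewrite pE -EFinD lee_fin.
(* The coefficient [1 / 2] of [z] lets [P (V & F)] be absorbed on the left; the errors then add up
   to at most [6 * eta / 8]. *)
have I8 : q' <= z / 2 + 4 * C ^+ 2 / ep ^+ 2 * S.
  rewrite -(ler_pM2l ep0); apply: (le_trans I7).
  rewrite le_eqVlt; apply/orP; left; apply/eqP; field; lra.
have -> : 8 * C ^+ 2 / ep ^+ 2 * S = 2 * (4 * C ^+ 2 / ep ^+ 2 * S) by field; lra.
lra.
Qed.

Local Notation sq := (square_sum xis a Rf).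

(** Each interval of generation [k] is adjacent to at most two dyadic points, so summing over the
    tents costs a factor 2. *)
Lemma sum_adjacent_square k j n :
  (\sum_(i < n) sq k j (index_adjacent i) <= 2%:E * sq 0 j predT)%E.
Proof.
have c0 s : (0 <= corr xis a Rf s s)%E by exact: corr_ge0.
rewrite /square_sum; under eq_bigr do rewrite big_mkcond /=.
rewrite exchange_big /= ge0_sume_distrr //.
apply: lee_sum => s _; rewrite -big_mkcond /= big_const.
have := card_adjacent_index n (take k s); set c := #|_|.
rewrite mule_natl mule2n; move: (corr xis a Rf s s) (c0 s) => z z0.
by case: c => [|[|[|//]]] _ /=; rewrite ?addr0 ?adde_ge0 ?leeDl.
Qed.

(** The diagonals are controlled by the drift, whose total over all generations is at most
    [Rf a]. *)
Lemma square_series_fin : (\sum_(0 <= j <oo) sq 0 j predT < +oo)%E.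
Proof.
have s0 j : (0 <= sq 0 j predT)%E by exact: square_sum_ge0.
have cv : cvgn (fun n => \sum_(0 <= j < n) sq 0 j predT)%E.
  exact: is_cvg_nneseries.
apply: (@le_lt_trans _ _ ((C * expR a)%:E * (Rf a)%:E)%E); last by rewrite -EFinM ltry.
apply: lime_le => //; apply: nearW => n; rewrite big_mkord.
have ce0 : 0 <= C * expR a by rewrite mulr_ge0 ?expR_ge0.
apply: (@le_trans _ _ (\sum_(j < n) (C * expR a)%:E *
    level xis a 0 j predT (fun=> 1%R) e)%E).
  by apply: lee_sum => j _; apply: square_sum_level.
rewrite -ge0_sume_distrr; last by move=> j _; exact: level_ge0.
by apply: lee_wpmul2l; rewrite ?lee_fin //; exact: (sum_level_le hlaw hindep a0).
Qed.

(** A union bound over the tents of one scale. Summing the bounds of [tent_tail] before summing over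
    generations keeps the constant independent of [k]. *)
Lemma tents_tail k (Y : nat -> T -> R) (ep : R) : 0 < ep ->
  (forall i, measurable_fun [set: T] (Y i)) ->
  (forall i, cvg_in_probability P (tent_real k i) (Y i)) ->
  (P (\big[setU/set0]_(i < (2 ^ k).+1) ([set w | (3 * ep <= Y i w)%R] `&` F)) <=
   (16 * C ^+ 2 / ep ^+ 2)%:E * \sum_(k <= j <oo) sq 0 j predT)%E.
Proof.
move=> ep0 mY cY.
have mF := measurable_below_forever xis a0.
have s0 k' j D : (0 <= sq k' j D)%E by exact: square_sum_ge0.
set n := (2 ^ k).+1.
have mW i : measurable ([set w | 3 * ep <= Y i w] `&` F).
  by apply: measurableI => //; exact: measurable_superlevel.
apply: (@le_trans _ _ (\sum_(i < n) P ([set w | (3 * ep <= Y i w)%R] `&` F))%E).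
  exact: (@Boole_inequality _ _ _ _ (fun i => [set w | 3 * ep <= Y i w] `&` F)).
pose ser i := (\sum_(k <= j <oo) sq k j (index_adjacent i))%E.
have ser0 i : (0 <= ser i)%E by apply: nneseries_ge0.
have tailfin : (\sum_(k <= j <oo) 2%:E * sq 0 j predT < +oo)%E.
  rewrite nneseriesZl // lte_mul_pinfty //.
  apply: le_lt_trans square_series_fin.
  rewrite [leRHS](nneseries_split 0 k) // add0n leeDr //.
  by apply: sume_ge0.
have sum_ser : (\sum_(i < n) ser i <= \sum_(k <= j <oo) 2%:E * sq 0 j predT)%E.
  rewrite /ser -nneseries_sum //; apply: lee_nneseries => [j _ _|j _].
    exact: sume_ge0.
  exact: sum_adjacent_square.
have ser_fin (i : 'I_n) : ser i \is a fin_num.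
  rewrite ge0_fin_numE //; apply: le_lt_trans tailfin.
  by apply: le_trans sum_ser; rewrite (bigD1 i) //= leeDl // sume_ge0.
have c0 : 0 <= 8 * C ^+ 2 / ep ^+ 2.
  by apply: divr_ge0; [apply: mulr_ge0 => //|]; exact: sqr_ge0.
apply: (@le_trans _ _ (\sum_(i < n) (8 * C ^+ 2 / ep ^+ 2)%:E * ser i)%E).
  apply: lee_sum => i _; rewrite -(fineK (ser_fin i)) -EFinM.
  apply: (tent_tail ep0 _ (mY i) (cY i)).
    exact: fine_ge0.
  by move=> m; rewrite fineK //; exact: nneseries_lim_ge.
rewrite -ge0_sume_distrr //.
apply: (@le_trans _ _ ((8 * C ^+ 2 / ep ^+ 2)%:E *
    \sum_(k <= j <oo) 2%:E * sq 0 j predT)%E).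
  by apply: lee_wpmul2l; rewrite ?lee_fin.
rewrite nneseriesZl // muleA -EFinM le_eqVlt; apply/orP; left; apply/eqP.
by congr (_%:E * _)%E; field; lra.
Qed.

(** A large atom forces the event [W k] at every scale [k], while [P (W k)] is at most a multiple of
    the tail of a convergent series. *)
Lemma large_atoms_negligible (mu1 : R.-ftker T ~> R)
  (hsupp : forall w : T, mu1 w (~` `[0, 1]) = 0%E)
  (hlim : weak_cvg_in_probability P
     (fun n w => critical_approx (fun s => xis s) n w) mu1) (ep : R) : 0 < ep ->
  P.-negligible [set w | F w /\ exists x, ((6 * ep)%:E <= mu1 w [set x])%E].
Proof.
move=> ep0.
pose Y k i w := (\int[mu1 w]_(x in `[0, 1]) tent k i x).
have mY k i : measurable_fun [set: T] (Y k i).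
  apply: measurableT_comp => //; apply: measurable_integral_tent => U mU.
  exact: measurable_kernel.
have cY k i : cvg_in_probability P (tent_real k i) (Y k i).
  have := hlim (tent k i); apply; apply: continuous_subspaceT => x.
  exact: continuous_tent.
have mF := measurable_below_forever xis a0.
pose W k := \big[setU/set0]_(i < (2 ^ k).+1)
   ([set w | 3 * ep <= Y k i w] `&` F).
have mW k : measurable (W k).
  apply: bigsetU_measurable => i _; apply: measurableI => //.
  exact: measurable_superlevel.
exists (\bigcap_k W k); split.
- exact: bigcapT_measurable.
- apply/eqP; rewrite eq_le measure_ge0 andbT.
  apply/lee_addgt0Pr => eta eta0; rewrite add0e.
  have c0 : 0 <= 16 * C ^+ 2 / ep ^+ 2.
    by apply: divr_ge0; [apply: mulr_ge0 => //|]; exact: sqr_ge0.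
  have s0 j : (0 <= sq 0 j predT)%E by exact: square_sum_ge0.
  have tl := nneseries_tail_cvg square_series_fin (fun j _ => s0 j).
  pose c := 16 * C ^+ 2 / ep ^+ 2.
  (* The denominator [1 + c] stays positive when [c = 0]. *)
  have eta1 : 0 < eta / (1 + c) by rewrite divr_gt0 // ltr_pwDl.
  have [N hN] := cvg0_near_le tl eta1.
  apply: (@le_trans _ _ (P (W N))).
    apply: le_measure; rewrite ?inE //; last exact: bigcap_inf.
    exact: bigcapT_measurable.
  apply: le_trans (tents_tail ep0 (mY N) (cY N)) _.
  apply: (@le_trans _ _ (c%:E * (eta / (1 + c))%:E)%E).
    by apply: lee_wpmul2l; [rewrite lee_fin|exact: hN].
  rewrite -EFinM lee_fin mulrA ler_pdivrMr ?ltr_pwDl // mulrC.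
  by rewrite ler_wpM2l ?(ltW eta0) // lerDr.
move=> w /= [Fw [x hx]] k _.
have x01 : 0 <= x <= 1.
  apply: contrapT => nx; move: hx; rewrite leNgt => /negP; apply.
  apply: (@le_lt_trans _ _ 0%E); last by rewrite lte_fin mulr_gt0.
  rewrite -(hsupp w); apply: le_measure; rewrite ?inE //.
    by apply: measurableC; exact: measurable_itv.
  by move=> y ->; rewrite /= in_itv.
(* This tent is at least [1 / 2] at the atom, so its integral is at least half of [6 * ep]. *)
have [i hi] := tent_ge_half k x01.
rewrite /W -(bigcup_mkord _ (fun i => [set w | 3 * ep <= Y k i w] `&` F)).
exists (val i); first exact: (ltn_ord i).
split => //=.
have m01 : measurable (`[0, 1] : set R) by exact: measurable_itv.
have fm : mu1 w `[0, 1]%classic \is a fin_num by exact: kernel_finite_transition.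
have t0 y : (0 <= (tent k i y)%:E)%E by rewrite lee_fin tent_ge0.
have mt : measurable_fun [set: R] (fun y => (tent k i y)%:E).
  by apply/measurable_EFinP; exact: measurable_tent.
have Ifin : (\int[mu1 w]_(x in `[0%R, 1%R]) (tent k i x)%:E)%E \is a fin_num.
  rewrite ge0_fin_numE ?integral_ge0 //.
  apply: (@le_lt_trans _ _ (\int[mu1 w]_(x in `[0%R, 1%R]) (cst 1%E) x)%E).
    apply: ge0_le_integral => //; first exact: measurable_funTS.
    by move=> y _; rewrite lee_fin tent_le1.
  by rewrite integral_cst // mul1e ltey_eq fm.
rewrite /Y /Rintegral -lee_fin fineK //.
apply: (@le_trans _ _ (\int[mu1 w]_(y in [set x]) (tent k i y)%:E)%E); last first.
  apply: (ge0_subset_integral _ (measurable_set1 x) m01) => //.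
    exact: (measurable_funTS mt).
  by move=> y -> /=; rewrite in_itv.
apply: (@le_trans _ _ (\int[mu1 w]_(y in [set x]) (cst (2^-1)%:E) y)%E); last first.
  apply: ge0_le_integral => //.
  - by move=> y _; rewrite lee_fin.
  - exact: (measurable_funTS mt).
  - by move=> y ->; rewrite lee_fin.
rewrite integral_cst //.
apply: (@le_trans _ _ ((2^-1)%:E * (6 * ep)%:E)%E).
  by rewrite -EFinM lee_fin; lra.
by apply: lee_wpmul2l.
Qed.

End atoms.

(** * Conclusion: exhaustion by integer barriers and by atom sizes *)

Theorem corollary2 (R : realType)
  (d0 : measure_display) (T0 : measurableType d0) (P0 : probability T0 R)
  (xi : {RV P0 >-> R})
  (hmean : ('E_P0[fun t => expR (xi t)] = (2^-1)%:E)%E)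
  (hcrit : ('E_P0[fun t => (xi t * expR (xi t))%R] = 0)%E)
  (hmoment : exists2 h : R, 0 < h &
     ('E_P0[fun t => expR ((1 + h) * xi t)%R] < +oo)%E)
  (d : measure_display) (T : measurableType d) (P : probability T R)
  (xis : seq bool -> {RV P >-> R})
  (hlaw : forall s : seq bool, s != [::] -> identically_distributed (xis s) xi)
  (hindep : mutually_independent [set s : seq bool | s != [::]] xis)
  (mu1 : R.-ftker T ~> R)
  (hsupp : forall w : T, mu1 w (~` `[0, 1]) = 0%E)
  (hlim : weak_cvg_in_probability P
     (fun n w => critical_approx (fun s => xis s) n w) mu1) :
  {ae P, forall w, no_atoms (mu1 w)}.
Proof.
have [h h0 hm] := hmoment.
have hmass := tilted_mass hmean.
have [Rf [e [C [[mR me] [R0 e0] hR [C0 hC] hU]]]] :=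
  walk_functions hmean hcrit h0 hm.
pose F n := below_forever xis (n%:R : R).
pose bad (p : nat) q := [set w | F p w /\
  exists x, ((6 * q.+1%:R^-1)%:E <= mu1 w [set x])%E].
have bad0 p q : P.-negligible (bad p q).
  have q0 : 0 < q.+1%:R^-1 :> R by rewrite invr_gt0 ltr0n.
  exact: (large_atoms_negligible hlaw hindep hmass mR me R0 e0 hR C0 hC hU
    (ler0n R p) hsupp hlim q0).
(* Almost surely some integer barrier is never crossed, since barrier [p] fails with probability at
   most [e^(-p)]. *)
have unb0 : P.-negligible (\bigcap_p ~` F p).
  have mF p : measurable (~` F p).
    by apply: measurableC; exact: measurable_below_forever (ler0n R p).
  exists (\bigcap_p ~` F p); split => //; first exact: bigcapT_measurable.
  apply/eqP; rewrite eq_le measure_ge0 andbT.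
  apply/lee_addgt0Pr => eta eta0; rewrite add0e.
  (* Then [p > 1 / eta], and [e^p >= 1 + p] yields [e^(-p) <= eta]. *)
  pose p := (Num.Def.trunc eta^-1).+1.
  apply: (@le_trans _ _ (P (~` F p))).
    apply: le_measure; rewrite ?inE //; last exact: bigcap_inf.
    exact: bigcapT_measurable.
  apply: (le_trans (below_forever_prob hlaw hindep (ler0n R p) hmass)).
  rewrite lee_fin expRN -[leRHS]invrK lef_pV2 ?posrE ?expR_gt0 ?invr_gt0 //.
  have ie0 : 0 <= eta^-1 by rewrite invr_ge0 ltW.
  have /andP[_ h1] := truncn_itv ie0.
  have := expR_ge1Dx (p%:R : R); rewrite -/p in h1; lra.
apply: (negligibleS _ (negligibleU (negligible_bigcup
  (fun p => negligible_bigcup (bad0 p))) unb0)).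
move=> w /= hw.
have [hF|hF] := pselect (exists p, F p w); last first.
  by right=> p _ Fp; apply: hF; exists p.
left; have [p Fp] := hF; exists p => //.
have [x hx] : exists x, mu1 w [set x] <> 0%E by apply/existsNP.
have fx : mu1 w [set x] \is a fin_num.
  by apply: kernel_finite_transition; exact: measurable_set1.
have r0 : 0 < fine (mu1 w [set x]).
  rewrite fine_gt0 // ltey_eq fx andbT lt_neqAle measure_ge0 andbT.
  by apply/eqP => /esym.
(* Truncation gives [6 / mass < q + 1], so the atom has mass at least [6 / (q + 1)]. *)
pose q := Num.Def.trunc (6 / fine (mu1 w [set x])).
exists q => //; split => //; exists x; rewrite -(fineK fx) lee_fin.
have /andP[_ h1] := truncn_itv (divr_ge0 (ler0n R 6) (ltW r0)).
rewrite -/q in h1.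
by rewrite ler_pdivrMr ?ltr0n // mulrC -ler_pdivrMr // ltW.
Qed.
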